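(* Let $p\in[1,\infty]$, $K\ge1$, $K'\ge0$. Let $F:\mathbb{T}\to\mathbb{C}$ be absolutely continuous with $\dot F\in L^{p}(\mathbb{T})$, and suppose $f=P[F]$ is a $(K,K')$-elliptic mapping in $\mathbb{D}$. Then both $f_z$ and $\overline{f_{\overline z}}$ belong to the Hardy space $\mathcal{H}^{p}(\mathbb{D})$.
   Context: $\mathbb{D}$ is the open unit disk, $\mathbb{T}=\partial\mathbb{D}$. For $z=x+iy$, $\partial/\partial z=\frac12(\partial_x-i\partial_y)$ and $\partial/\partial\overline z=\frac12(\partial_x+i\partial_y)$. For $F\in L^1(\mathbb{T})$ the Poisson integral is $P[F](z)=\int_0^{2\pi}P(z,e^{i\theta})F(e^{i\theta})\,d\theta$ with $P(z,e^{i\theta})=\frac{1}{2\pi}\frac{1-|z|^2}{|1-ze^{-i\theta}|^2}$. $\dot F(e^{i\theta})=\frac{d}{d\theta}F(e^{i\theta})$ (defined a.e.); $L^p(\mathbb{T})$ has norm $\|F\|_{L^p}=\big(\frac{1}{2\pi}\int_0^{2\pi}|F(e^{i\theta})|^pd\theta\big)^{1/p}$ (ess sup if $p=\infty$). For a $C^1$ map $f$, $\|D_f(z)\|=|f_z(z)|+|f_{\overline z}(z)|$ and the Jacobian is $J_f=|f_z|^2-|f_{\overline z}|^2$; $f$ is sense-preserving if $J_f>0$. A sense-preserving continuously differentiable mapping $f:\mathbb{D}\to\mathbb{C}$ that is absolutely continuous on lines in $\mathbb{D}$ is a $(K,K')$-elliptic mapping if $\|D_f(z)\|^2\le KJ_f(z)+K'$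 for all $z\in\mathbb{D}$. For $p\in(0,\infty)$, $\mathcal{H}^p(\mathbb{D})$ is the space of analytic $g$ on $\mathbb{D}$ with $\sup_{0<r<1}\big(\frac1{2\pi}\int_0^{2\pi}|g(re^{i\theta})|^pd\theta\big)^{1/p}<\infty$; $\mathcal{H}^\infty(\mathbb{D})$ is the space of bounded analytic functions on $\mathbb{D}$. *)

(* Defs.v *)
(* MathComp + MathComp-Analysis, complex numbers = R[i] (mathcomp-real-closed). *)
From HB Require Import structures.
From mathcomp Require Import all_boot all_order all_algebra.
From mathcomp Require Import all_classical all_reals all_analysis.
From mathcomp.real_closed Require Import complex.
Set Implicit Arguments. Unset Strict Implicit. Unset Printing Implicit Defensive.
Import Order.TTheory GRing.Theory Num.Theory.
Import numFieldTopology.Exports numFieldNormedType.Exports.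
Local Open Scope classical_set_scope.
Local Open Scope ring_scope.
Local Open Scope complex_scope.

(* R[i] with its canonical (norm-induced) topology, as for any numFieldType. *)
HB.instance Definition _ (R : rcfType) := PseudoPointedMetric.copy R[i] R[i]^o.

(* Modulus |z| of a complex number, as a real number. *)
Definition creal (R : realType) (z : R[i]) : R := let: a +i* _ := z in a.
Definition cimag (R : realType) (z : R[i]) : R := let: _ +i* b := z in b.
Definition cabs (R : realType) (z : R[i]) : R :=
  Num.sqrt (creal z ^+ 2 + cimag z ^+ 2).

(* The open unit disk. *)
Definition Disk (R : realType) : set R[i] := [set z | cabs z < 1].

(* e^{it} *)
Definition expi (R : realType) (t : R) : R[i] := cos t +i* sin t.

(* The interval [0, 2 pi], parametrizing the unit circle T via t |-> e^{it}. *)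
Definition I2pi (R : realType) : set R := `[0, pi *+ 2]%classic.

(* Poisson kernel P(z, e^{it}) = (1/2pi) (1-|z|^2)/|1 - z e^{-it}|^2 *)
Definition poisson_kernel (R : realType) (z : R[i]) (t : R) : R :=
  (pi *+ 2)^-1 * ((1 - cabs z ^+ 2) / cabs (1 - z * (expi t)^*) ^+ 2).

(* Poisson integral P[F](z) = int_0^{2pi} P(z,e^{it}) F(e^{it}) dt,
   where F : R -> R[i] is t |-> F(e^{it}); computed on real and imaginary parts. *)
Definition poisson_integral (R : realType) (F : R -> R[i]) (z : R[i]) : R[i] :=
  (Rintegral lebesgue_measure (@I2pi R) (fun t => poisson_kernel z t * creal (F t)))%:C
  + 'i * (Rintegral lebesgue_measure (@I2pi R)
                    (fun t => poisson_kernel z t * cimag (F t)))%:C.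

(* Partial derivatives d/dx and d/dy of f : C -> C at z. *)
Definition dquot_x (R : realType) (f : R[i] -> R[i]) (z : R[i]) (t : R) : R[i] :=
  (f (z + t%:C) - f z) / t%:C.
Definition dquot_y (R : realType) (f : R[i] -> R[i]) (z : R[i]) (t : R) : R[i] :=
  (f (z + 'i * t%:C) - f z) / t%:C.
Definition pdx (R : realType) (f : R[i] -> R[i]) (z : R[i]) : R[i] :=
  lim (dquot_x f z @ (0 : R)^').
Definition pdy (R : realType) (f : R[i] -> R[i]) (z : R[i]) : R[i] :=
  lim (dquot_y f z @ (0 : R)^').

(* Wirtinger derivatives f_z = (f_x - i f_y)/2, f_zbar = (f_x + i f_y)/2. *)
Definition dz (R : realType) (f : R[i] -> R[i]) (z : R[i]) : R[i] :=
  (pdx f z - 'i * pdy f z) / 2.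
Definition dzbar (R : realType) (f : R[i] -> R[i]) (z : R[i]) : R[i] :=
  (pdx f z + 'i * pdy f z) / 2.

(* ||D_f(z)|| = |f_z| + |f_zbar| ; J_f = |f_z|^2 - |f_zbar|^2 *)
Definition normD (R : realType) (f : R[i] -> R[i]) (z : R[i]) : R :=
  cabs (dz f z) + cabs (dzbar f z).
Definition jacobian (R : realType) (f : R[i] -> R[i]) (z : R[i]) : R :=
  cabs (dz f z) ^+ 2 - cabs (dzbar f z) ^+ 2.

(* f is continuously differentiable in D: both partial derivatives exist at
   every point of D and are continuous on D. *)
Definition C1_on_disk (R : realType) (f : R[i] -> R[i]) : Prop :=
  forall z, Disk z ->
    [/\ dquot_x f z @ (0 : R)^' --> pdx f z,
        dquot_y f z @ (0 : R)^' --> pdy f z,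
        {for z, continuous (pdx f)} &
        {for z, continuous (pdy f)}].

(* Absolute continuity of g : R -> C on [a, b]. *)
Definition abs_cont_on (R : realType) (a b : R) (g : R -> R[i]) : Prop :=
  forall e : R, 0 < e -> exists2 d : R, 0 < d &
    forall (n : nat) (s t : 'I_n -> R),
      (forall i, a <= s i /\ s i <= t i /\ t i <= b) ->
      (forall i j, i != j -> t i <= s j \/ t j <= s i) ->
      \sum_(i < n) (t i - s i) < d ->
      \sum_(i < n) cabs (g (t i) - g (s i)) < e.

(* Absolutely continuous on lines in D: for every closed rectangle
   [a,b] x [c,d] contained in D, f is absolutely continuous on almost every
   horizontal and almost every vertical segment of the rectangle. *)
Definition ACL_on_disk (R : realType) (f : R[i] -> R[i]) : Prop :=
  forall a b c d : R,
    (forall x y, a <= x <= b -> c <= y <= d -> Disk (x +i* y)) ->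
    {ae lebesgue_measure, forall y : R, c <= y <= d ->
        abs_cont_on a b (fun x => f (x +i* y))} /\
    {ae lebesgue_measure, forall x : R, a <= x <= b ->
        abs_cont_on c d (fun y => f (x +i* y))}.

(* (K,K')-elliptic mapping in D. *)
Definition elliptic (R : realType) (K K' : R) (f : R[i] -> R[i]) : Prop :=
  [/\ C1_on_disk f,
      ACL_on_disk f,
      (forall z, Disk z -> 0 < jacobian f z) &
      (forall z, Disk z -> normD f z ^+ 2 <= K * jacobian f z + K')].

(* G (a function of t, i.e. of e^{it}) belongs to L^p(T), p in [1, +oo]. *)
Definition Lp_circle (R : realType) (p : \bar R) (G : R -> R[i]) : Prop :=
  [/\ measurable_fun (@I2pi R) (fun t => creal (G t)),
      measurable_fun (@I2pi R) (fun t => cimag (G t)) &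
      match p with
      | r%:E => (\int[lebesgue_measure]_(t in @I2pi R)
                   (cabs (G t) `^ r)%:E < +oo)%E
      | +oo%E => exists M : R, {ae lebesgue_measure, forall t,
                    I2pi t -> cabs (G t) <= M}
      | -oo%E => False
      end].

(* G is (a version of) the a.e. derivative d/dt F(e^{it}). *)
Definition ae_derivative (R : realType) (F G : R -> R[i]) : Prop :=
  {ae lebesgue_measure, forall t : R, I2pi t ->
     (fun h : R => (F (t + h) - F t) / h%:C) @ (0 : R)^' --> G t}.

(* Analytic (holomorphic) in D. *)
Definition analytic_on_disk (R : realType) (g : R[i] -> R[i]) : Prop :=
  forall z, Disk z -> exists l : R[i],
    (fun h : R[i] => (g (z + h) - g z) / h) @ (0 : R[i])^' --> l.

(* Hardy space H^p(D), p in (0, +oo]. *)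
Definition hardy (R : realType) (p : \bar R) (g : R[i] -> R[i]) : Prop :=
  analytic_on_disk g /\
  match p with
  | r%:E => exists M : R, forall rho : R, (0 < rho < 1)%R ->
      (((pi *+ 2)^-1)%:E * \int[lebesgue_measure]_(t in @I2pi R)
          (cabs (g (rho%:C * expi t)) `^ r)%:E) `^ r^-1 <= M%:E
  | +oo%E => exists M : R, forall z, Disk z -> (cabs (g z) <= M)%R
  | -oo%E => False
  end%E.

(* Main.v *)
(** Writing [f = P[F]] as [A z + B (conj z)] with [A], [B] Cauchy-type integrals of [F] gives
    [f_z = A' z] and [f_zbar = B' (conj z)], so that [f_z] and [conj f_zbar] are analytic.
    Since [F] is absolutely continuous, integrating by parts against the Poisson kernel turns
    [z f_z - conj z f_zbar], which is [-i] times the angular derivative of [f], into [-i P[F']].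
    With [D = |f_z| + |f_zbar|] and [l = |f_z| - |f_zbar| > 0], ellipticity reads
    [D^2 <= K D l + K'], whence [D <= K l + sqrt K']; as [|z| l <= |z f_z - conj z f_zbar|],
    [D] is bounded by [2 K |P[F']| + sqrt K'] for [|z| >= 1/2], and by a constant for
    [|z| <= 1/2].  Finally [P] contracts [L^p]: Young's inequality gives
    [P[g]^p <= P[g^p]], and Tonelli integrates the right-hand side over circles. *)
Require Import Defs.
From HB Require Import structures.
From mathcomp Require Import all_boot all_order all_algebra.
From mathcomp Require Import all_classical all_reals all_analysis.
From mathcomp.real_closed Require Import complex.
From mathcomp Require Import measurable_realfun ring lra.
Import Order.TTheory GRing.Theory Num.Theory.
Import numFieldTopology.Exports numFieldNormedType.Exports.
Local Open Scope classical_set_scope.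
Local Open Scope ring_scope.
Local Open Scope complex_scope.

(** * Absolutely continuous functions *)

(** The integration by parts concerns an [F] that is merely absolutely continuous, so it rests on
    the fundamental theorem of calculus for such functions. That theorem is reduced to one fact: an
    absolutely continuous function whose derivative vanishes almost everywhere has equal end values.
    The fact is obtained by gluing local estimates along the interval instead of extracting a
    covering. The other obstacle is the origin, since the angular derivative controls only [|z| l].
    Dividing by [|z|] is therefore confined to [|z| >= 1/2], which costs the factor 2, and the inner
    disk is handled by the Cauchy kernels, which stay bounded there. Complex integrals are estimated
    through their real and imaginary parts, so several constants carry a spare factor 2; membership
    in a Hardy space does not see it. *)

Section ac.
Variable R : realType.
Notation mu := (@lebesgue_measure R).

(* Cousin's lemma; [Psi] plays the role of an additive estimate over a tagged partition. *)
Lemma local_to_global (a b : R) (Psi : R -> R -> Prop) : a <= b ->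
  (forall x y z, x <= y -> y <= z -> Psi x y -> Psi y z -> Psi x z) ->
  (forall t, a <= t <= b -> exists2 d : R, 0 < d & forall x y, a <= x -> x <= t ->
     t <= y -> y <= b -> t - d < x -> y < t + d -> Psi x y) ->
  Psi a b.
Proof.
move=> ab tr loc.
pose S := [set x | a <= x <= b /\ Psi a x].
have Sa : S a.
  split; first by rewrite lexx.
  have [|d d0 H] := loc a; first by rewrite lexx.
  by apply: H => //; lra.
have ubS : ubound S b by move=> x [/andP[]].
have hS : has_sup S by split; [exists a|exists b].
have aS : a <= sup S by apply: ub_le_sup => //; exists b.
have Sb : sup S <= b by apply: ge_sup => //; exists a.
have [|d d0 H] := loc (sup S); first by rewrite aS.
have [x Sx xd] := sup_adherent d0 hS.
have xS : x <= sup S by apply: ub_le_sup => //; exists b.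
have [/andP[ax xb] Px] := Sx.
(* A point [x] of [S] close to [sup S] on the left is joined to [y] by an interval tagged at
   [sup S]. If [sup S < b], some such [y] lies beyond [sup S] and still in [S], which is absurd. *)
have key y : sup S <= y -> y <= b -> y < sup S + d -> Psi a y.
  move=> Sy yb yd; apply: (tr a x y) => //; first by lra.
  by apply: H.
have [Sb'|] := eqVneq (sup S) b.
  by rewrite -[X in Psi _ X]Sb'; apply: key => //; lra.
move=> Sneb; have Slb : sup S < b by rewrite lt_neqAle Sneb.
pose y := Num.min b (sup S + d / 2).
have yb : y <= b by rewrite ge_min lexx.
have Sy : sup S < y by rewrite lt_min Slb; lra.
have yd : y <= sup S + d / 2 by rewrite ge_min lexx orbT.
have : S y by split; [lra|apply: key; lra].
by move=> /(ub_le_sup (ex_intro _ b ubS)); lra.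
Qed.

Definition rabs_cont (a b : R) (h : R -> R) :=
  forall e : R, 0 < e -> exists2 d : R, 0 < d &
    forall (n : nat) (s t : 'I_n -> R),
      (forall i, a <= s i /\ s i <= t i /\ t i <= b) ->
      (forall i j, i != j -> t i <= s j \/ t j <= s i) ->
      \sum_(i < n) (t i - s i) < d ->
      \sum_(i < n) `|h (t i) - h (s i)| < e.

(* Points where the derivative fails lie in an open set [U] of measure less than the [d] of
   absolute continuity: intervals tagged there contribute at most [e], all the others at
   most [e] times their length. *)
Lemma rabs_cont_deriv0 (a b : R) (h : R -> R) : a <= b -> rabs_cont a b h ->
  {ae mu, forall t, a < t < b -> forall e : R, 0 < e -> exists2 d : R, 0 < d &
    forall x, `|x - t| < d -> `|h x - h t| <= e * `|x - t|} ->
  h b = h a.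
Proof.
move=> ab ach [N [mN N0 dhN]].
(* Taking for [e] the quantity [|h b - h a|] divided by [2 (b - a + 1)] turns the bound into
   [|h b - h a| / 2], which forces the increment to vanish. *)
suff bnd (e : R) : 0 < e -> `|h b - h a| <= e * (b - a) + e.
  have [//|hne] := eqVneq (h b) (h a).
  have h0 : 0 < `|h b - h a| by rewrite normr_gt0 subr_eq0.
  have ba : 0 <= b - a by rewrite subr_ge0.
  have c0 : 0 < 2 * (b - a + 1) by lra.
  have := bnd (`|h b - h a| / (2 * (b - a + 1))) (divr_gt0 h0 c0).
  suff -> : `|h b - h a| / (2 * (b - a + 1)) * (b - a) +
     `|h b - h a| / (2 * (b - a + 1)) = `|h b - h a| / 2 by lra.
  by field; lra.
move=> e0; have [d d0 hd] := ach _ e0.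
(* The end points join the exceptional set because the derivative is given only at interior
   points. *)
pose N' := N `|` [set a] `|` [set b].
have mN' : measurable N'.
  by do 2?apply: measurableU => //; exact: measurable_set1.
have N'0 : mu N' = 0%E.
  apply/negligibleP => //; apply: negligibleU; first apply: negligibleU.
  - by apply/negligibleP.
  - by apply/negligibleP; [exact: measurable_set1|exact: lebesgue_measure_set1].
  - by apply/negligibleP; [exact: measurable_set1|exact: lebesgue_measure_set1].
have [U [oU NU Ud]] : exists U, [/\ open U, N' `<=` U & (mu U < d%:E)%E].
  have N'oo : (mu N' < +oo)%E by rewrite N'0 ltry.
  have [U [oU NU Ud]] := lebesgue_regularity_outer mN' N'oo d0.
  exists U; split => //.
  have -> : mu U = (mu N' + mu (U `\` N'))%E.
    rewrite -measureU//; first by rewrite setDE setUIr setUCr setIT setUidr.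
    - by apply: measurableD => //; exact: measurable_realfun.open_measurable.
    - by rewrite setIDA setIC -setIDA setDv setI0.
  by rewrite N'0 add0e.
have mU : measurable U by exact: measurable_realfun.open_measurable.
(* The lengths are compared with the measure of [U] inside [[x, y[], not with that of [U]: this
   makes the estimate additive, half-open intervals being disjoint when concatenated. *)
pose Psi x y := exists (n : nat) (s t : 'I_n -> R),
  [/\ (forall i, x <= s i /\ s i <= t i /\ t i <= y),
      (forall i j, i != j -> t i <= s j \/ t j <= s i),
      ((\sum_(i < n) (t i - s i))%:E <= mu (U `&` `[x, y[%classic))%E &
      `|h y - h x| <= e * (y - x) + \sum_(i < n) `|h (t i) - h (s i)|].
suff : Psi a b.
  move=> [n [s [t [st no lst hst]]]].
  apply: (le_trans hst); rewrite lerD2l; apply/ltW/hd => //.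
  rewrite -lte_fin; apply: le_lt_trans lst _; apply: le_lt_trans Ud.
  by apply: le_measure; rewrite ?inE//; apply: measurableI.
apply: (@local_to_global a b) => //.
- move=> x y z xy yz [n [s [t [st no lst hst]]]] [n' [s' [t' [st' no' lst' hst']]]].
  exists (n + n')%N,
    (fun i => match fintype.split i with inl j => s j | inr j => s' j end),
    (fun i => match fintype.split i with inl j => t j | inr j => t' j end).
  have sl (i : 'I_n) : fintype.split (lshift n' i) = inl i by rewrite (unsplitK (inl i)).
  have sr (i : 'I_n') : fintype.split (rshift n i) = inr i by rewrite (unsplitK (inr i)).
  split.
  + move=> i; case: fintype.split => j.
      by have [? [? ?]] := st j; lra.
    by have [? [? ?]] := st' j; lra.
  + move=> i j; have iE := splitK i; have jE := splitK j.
    rewrite -iE -jE !unsplitK.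
    case: (fintype.split i) => i'; case: (fintype.split j) => j'.
    * by move=> ij; apply: no; apply: contra ij => /eqP ->.
    * by move=> _; left; have [? [? ?]] := st i'; have [? [? ?]] := st' j'; lra.
    * by move=> _; right; have [? [? ?]] := st j'; have [? [? ?]] := st' i'; lra.
    * by move=> ij; apply: no'; apply: contra ij => /eqP ->.
  + rewrite big_split_ord /=.
    under eq_bigr do rewrite sl.
    under [X in _ + X]eq_bigr do rewrite sr.
    have -> : U `&` `[x, z[ = (U `&` `[x, y[) `|` (U `&` `[y, z[).
      rewrite -setIUr; congr (_ `&` _); apply/seteqP; split => w /=.
        rewrite !in_itv/= => /andP[xw wz]; have [wy|yw] := ltP w y; [left|right];
        by rewrite ?xw.
      by rewrite !in_itv/= => -[] /andP[? ?]; apply/andP; split; lra.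
    rewrite measureU//; [|by apply: measurableI|by apply: measurableI|].
      by rewrite EFinD leeD.
    apply/seteqP; split => // w /= [[_ +] [_ +]].
    by rewrite !in_itv/= => /andP[? ?] /andP[? ?]; lra.
  + rewrite big_split_ord /=.
    under eq_bigr do rewrite sl.
    under [X in _ <= _ + (_ + X)]eq_bigr do rewrite sr.
    have := ler_distD (h y) (h z) (h x); lra.
- move=> t /andP[at_ tb].
  have [tN|tN] := pselect (N' t).
    have /nbhs_ballP[r /= r0 rU] : nbhs t U by apply: open_nbhs_nbhs; split => //; exact: NU.
    exists r => // x y ax xt ty yb xr yr.
    (* At an exceptional tag the whole interval lies in [U] and is taken as the only member of the
       family. *)
    exists 1%N, (fun=> x), (fun=> y); split.
    + by move=> _; split => //; split => //; exact: le_trans ty.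
    + by move=> i j; rewrite !ord1.
    + rewrite big_ord1; have -> : U `&` `[x, y[ = `[x, y[%classic.
        apply/setIidr => w /=; rewrite in_itv/= => /andP[xw wy]; apply: rU.
        by rewrite /ball/= ltr_norml; lra.
      rewrite lebesgue_measure_itv/= lte_fin; case: ltP => xy.
        by rewrite EFinB.
      by rewrite lee_fin; lra.
    + by rewrite big_ord1; have := mulr_ge0 (ltW e0) (_ : 0 <= y - x); lra.
  have tab : a < t < b.
    apply/andP; split; rewrite lt_neqAle ?at_ ?tb andbT; apply/eqP.
      by move=> E; apply: tN; left; right.
    by move=> E; apply: tN; right.
  have [|r r0 hr] := (_ : forall e : R, 0 < e -> exists2 d : R, 0 < d &
    forall x, `|x - t| < d -> `|h x - h t| <= e * `|x - t|) e e0.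
    apply: contrapT => H; apply: tN; left; left; apply: dhN => /=.
    by move=> /(_ tab).
  exists r => // x y ax xt ty yb xr yr.
  (* At a good tag the family is empty: [x <= t <= y] makes [|x - t| + |y - t|] equal to [y - x], so
     the derivative estimate alone suffices. *)
  exists 0%N, (fun=> 0), (fun=> 0); split => //.
  + by case.
  + by case.
  + by rewrite big_ord0.
  + rewrite big_ord0 addr0.
    have xt0 : x - t <= 0 by rewrite subr_le0.
    have yt0 : 0 <= y - t by rewrite subr_ge0.
    have /hr : `|x - t| < r by rewrite ler0_norm //; lra.
    have /hr : `|y - t| < r by rewrite ger0_norm //; lra.
    rewrite (ler0_norm xt0) (ger0_norm yt0).
    have := ler_distD (h t) (h y) (h x); rewrite (distrC (h t)); lra.
Qed.

Lemma rabs_contB (a b : R) (f g : R -> R) : rabs_cont a b f -> rabs_cont a b g ->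
  rabs_cont a b (fun x => f x - g x).
Proof.
move=> acf acg e e0; have e2 : 0 < e / 2 by lra.
have [d1 d10 H1] := acf _ e2; have [d2 d20 H2] := acg _ e2.
exists (Num.min d1 d2); first by rewrite lt_min d10.
move=> n s t st no; rewrite lt_min => /andP[l1 l2].
have := H1 n s t st no l1; have := H2 n s t st no l2.
have : \sum_(i < n) `|f (t i) - g (t i) - (f (s i) - g (s i))| <=
   \sum_(i < n) (`|f (t i) - f (s i)| + `|g (t i) - g (s i)|).
  apply: ler_sum => i _.
  by rewrite (_ : f _ - g _ - _ = (f (t i) - f (s i)) - (g (t i) - g (s i)))
    ?ler_normB//; ring.
rewrite big_split /=; lra.
Qed.

(** The integral of [|g|] over a set is small once the measure of the set is. This is applied to the
    union of the []s i, t i]], half-open so that non-overlapping intervals become disjoint. *)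
Lemma rabs_cont_integral (a b : R) (g : R -> R) :
  mu.-integrable setT (EFin \o g) ->
  rabs_cont a b (fun x => \int[mu]_(t in `[a, x]) g t).
Proof.
move=> ig e e0; have [d [d0 hd]] := integral_normr_continuous ig e0.
exists d => // n s t st no lst.
have mI i : measurable (`]s i, t i]%classic : set R) by exact: measurable_itv.
have tI : trivIset [set: 'I_n] (fun i => `]s i, t i]%classic : set R).
  apply/trivIsetP => i j _ _ ij; apply/seteqP; split => // w /=.
  rewrite !in_itv/= => -[/andP[? ?] /andP[? ?]].
  by have [?|?] := no i j ij; lra.
have iI (D : set R) : measurable D -> mu.-integrable D (EFin \o g).
  by move=> mD; exact: integrableS ig.
have muI i : (mu `]s i, t i]%classic <= (t i - s i)%:E)%E.
  have [? [? ?]] := st i.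
  rewrite lebesgue_measure_itv/= lte_fin; case: ltP => _; rewrite lee_fin; lra.
have mB : measurable (\big[setU/set0]_(i < n) `]s i, t i]%classic : set R).
  by apply: bigsetU_measurable => i _; exact: mI.
have muB : (mu (\big[setU/set0]_(i < n) `]s i, t i]%classic) < d%:E)%E.
  rewrite measure_bigsetU_ord//.
  apply: le_lt_trans (_ : ((\sum_(i < n) (t i - s i))%:E < _)%E); last by rewrite lte_fin.
  by rewrite -sumEFin; apply: lee_sum => i _; exact: muI.
apply: le_lt_trans (hd _ mB muB).
have nI (D : set R) : measurable D -> mu.-integrable D (fun x => `|g x|%:E).
  by move=> mD; have := iI _ mD => /integrable_abse.
rewrite -lee_fin [leRHS]fineK; last exact: integrable_fin_num (nI _ mB).
rewrite ge0_integral_bigsetU//.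
- rewrite -sumEFin; apply: lee_sum => i _.
  have [ai [si ti]] := st i.
  rewrite Rintegral_itvB; [|exact: iI|by rewrite bnd_simp|by rewrite bnd_simp].
  rewrite -[leRHS]fineK; last exact: integrable_fin_num (nI _ (mI i)).
  by rewrite lee_fin; apply: le_normr_Rintegral => //; exact: iI.
- exact: index_enum_uniq.
- by apply: sub_trivIset tI.
- by have /measurable_int := nI _ mB.
Qed.

Lemma deriv0_epsP (H : R -> R) (t : R) :
  (fun h => (H (t + h) - H t) / h) @ 0^' --> (0 : R) ->
  forall e : R, 0 < e -> exists2 d : R, 0 < d &
    forall x, `|x - t| < d -> `|H x - H t| <= e * `|x - t|.
Proof.
move=> /cvgrPdist_lt cH e e0.
have /nbhs_ballP[d /= d0 hd] := cH e e0.
exists d => // x xd; have [->|xt] := eqVneq x t; first by rewrite !subrr normr0 mulr0.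
have := hd (x - t); rewrite /ball/= sub0r normrN => /(_ xd).
rewrite subr_eq0 => /(_ xt); rewrite sub0r normrN (addrC t) subrK normrM normfV.
by rewrite ltr_pdivrMr ?normr_gt0 ?subr_eq0// => /ltW.
Qed.

(** By Lebesgue differentiation, [F] minus the indefinite integral of [g] has derivative zero almost
    everywhere; it is absolutely continuous, hence has equal end values. *)
Lemma rabs_cont_FTC2 (a b : R) (F g : R -> R) : a <= b -> rabs_cont a b F ->
  mu.-integrable `[a, b] (EFin \o g) ->
  {ae mu, forall t, a < t < b -> (fun h => (F (t + h) - F t) / h) @ 0^' --> g t} ->
  \int[mu]_(t in `[a, b]) g t = F b - F a.
Proof.
move=> ab acF ig dF.
(* Extension by zero makes [g] integrable on the whole line, the setting of the differentiation
   theorem. *)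
pose gab := g \_ `[a, b].
have igab : mu.-integrable setT (EFin \o gab).
  by rewrite -restrict_EFin; apply/integrable_restrict => //=; rewrite setTI.
pose Phi x := (\int[mu]_(t in `[a, x]) gab t).
have acPhi : rabs_cont a b Phi by exact: rabs_cont_integral.
have lgab : locally_integrable setT gab.
  by apply: integrable_locally => //; exact: openT.
have igy y : mu.-integrable [set` Interval (BLeft a) (BRight y)] (EFin \o gab).
  by apply: integrableS igab => //; exact: measurable_itv.
have := @FTC1 R gab (BLeft a) igy lgab; rewrite -/Phi /= => dPhi.
have := rabs_cont_deriv0 a b _ ab (rabs_contB _ _ _ _ acF acPhi).
have -> : Phi a = 0 by rewrite /Phi set_itv1 Rintegral_set1.
have -> : Phi b = \int[mu]_(t in `[a, b]) g t.
  by apply: eq_Rintegral => x xab; rewrite /gab patchE xab.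
move=> H; rewrite subr0 in H; apply/eqP; rewrite eq_sym subr_eq addrC -subr_eq; apply/eqP; apply: H.
have aeF := ae_filter_ringOfSetsType mu.
apply: filterS2 dF dPhi => t dFt dPhit /andP[at_ tb].
apply: deriv0_epsP.
have [|dPt Ptg] := dPhit; first by rewrite lte_fin.
have -> : (fun h => (F (t + h) - Phi (t + h) - (F t - Phi t)) / h) =
  (fun h => (F (t + h) - F t) / h - h^-1 *: (Phi (h *: 1 + t) - Phi t)).
  by apply/funext => h; rewrite /GRing.scale/= mulr1 (addrC h); ring.
have c1 : (fun h => (F (t + h) - F t) / h) @ 0^' --> g t by apply: dFt; rewrite at_.
have c2 : (fun h => h^-1 *: (Phi (h *: 1 + t) - Phi t)) @ 0^' --> g t.
  have -> : g t = derive1 Phi t by rewrite Ptg /gab patchE mem_set//= in_itv/= !ltW.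
  by rewrite derive1E; exact: dPt.
by have := cvgB c1 c2; rewrite subrr; apply.
Qed.
End ac.

(** * Moduli and limits of complex numbers *)

Section cpx.
Context {R : realType}.
Implicit Types (z w : R[i]) (x y t : R).

Lemma cabsE z : cabs z = Normc.normc z.
Proof. by case: z. Qed.
Lemma normc_cabs z : `|z| = (cabs z)%:C.
Proof. by rewrite cabsE. Qed.
Lemma cabsM z w : cabs (z * w) = cabs z * cabs w.
Proof. by rewrite !cabsE Normc.normcM. Qed.
Lemma cabsV z : cabs z^-1 = (cabs z)^-1.
Proof. by rewrite !cabsE Normc.normcV. Qed.
Lemma cabsD z w : cabs (z + w) <= cabs z + cabs w.
Proof. by rewrite -lecR rmorphD /= -!normc_cabs ler_normD. Qed.
Lemma cabsN z : cabs (- z) = cabs z.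
Proof. by apply: complexI; rewrite -!normc_cabs normrN. Qed.
Lemma cabsB z w : cabs (z - w) <= cabs z + cabs w.
Proof. by rewrite -(cabsN w) cabsD. Qed.
Lemma cabsBC z w : cabs (z - w) = cabs (w - z).
Proof. by rewrite -cabsN opprB. Qed.
Lemma lecabs_sub z w : cabs z - cabs w <= cabs (z - w).
Proof. by have := cabsD (z - w) w; rewrite subrK; lra. Qed.
Lemma cabs0 : cabs (0 : R[i]) = 0.
Proof. by rewrite cabsE Normc.normc0. Qed.
Lemma cabs1 : cabs (1 : R[i]) = 1.
Proof. by rewrite cabsE Normc.normc1. Qed.
Lemma cabs_ge0 z : 0 <= cabs z.
Proof. exact: sqrtr_ge0. Qed.
Lemma cabs_eq0 z : (cabs z == 0) = (z == 0).
Proof.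
apply/eqP/eqP => [|->]; last exact: cabs0.
by rewrite cabsE => /Normc.eq0_normc.
Qed.
Lemma cabs_gt0 z : (0 < cabs z) = (z != 0).
Proof. by rewrite lt0r cabs_eq0 cabs_ge0 andbT. Qed.
Lemma cabsJ z : cabs z^* = cabs z.
Proof. by case: z => a b; rewrite /cabs /= sqrrN. Qed.
Lemma cabs_sqr z : cabs z ^+ 2 = creal z ^+ 2 + cimag z ^+ 2.
Proof. by rewrite sqr_sqrtr// addr_ge0 ?sqr_ge0. Qed.
Lemma cabs_real x : cabs x%:C = `|x|.
Proof. by rewrite /cabs /= expr0n addr0 sqrtr_sqr. Qed.
Lemma cabs_i : cabs ('i : R[i]) = 1.
Proof. by rewrite /cabs /= expr0n add0r expr1n sqrtr1. Qed.
Lemma creal_le_cabs z : `|creal z| <= cabs z.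
Proof. by rewrite -sqrtr_sqr ler_wsqrtr// lerDl sqr_ge0. Qed.
Lemma cimag_le_cabs z : `|cimag z| <= cabs z.
Proof. by rewrite -sqrtr_sqr ler_wsqrtr// lerDr sqr_ge0. Qed.
Lemma cpxE z : z = (creal z)%:C + 'i * (cimag z)%:C.
Proof. by case: z => a b; rewrite {1}[_ +i* _]complexE /=. Qed.
Lemma cabs_le z : cabs z <= `|creal z| + `|cimag z|.
Proof.
rewrite {1}(cpxE z); apply: le_trans (cabsD _ _) _.
by rewrite cabsM cabs_i !cabs_real mul1r.
Qed.
Lemma cabs_expi t : cabs (expi t) = 1.
Proof. by rewrite /cabs /= cos2Dsin2 sqrtr1. Qed.
Lemma crealD z w : creal (z + w) = creal z + creal w.
Proof. by case: z; case: w. Qed.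
Lemma cimagD z w : cimag (z + w) = cimag z + cimag w.
Proof. by case: z; case: w. Qed.
Lemma crealB z w : creal (z - w) = creal z - creal w.
Proof. by case: z; case: w. Qed.
Lemma cimagB z w : cimag (z - w) = cimag z - cimag w.
Proof. by case: z; case: w. Qed.
Lemma crealM z w : creal (z * w) = creal z * creal w - cimag z * cimag w.
Proof. by case: z; case: w. Qed.
Lemma cimagM z w : cimag (z * w) = creal z * cimag w + cimag z * creal w.
Proof. by case: z => a b; case: w => c d /=. Qed.
Lemma crealdR z x : creal (z / x%:C) = creal z / x.
Proof. by rewrite -fmorphV crealM /= mulr0 subr0. Qed.
Lemma cimagdR z x : cimag (z / x%:C) = cimag z / x.
Proof. by rewrite -fmorphV cimagM /= mulr0 add0r. Qed.

Lemma cabsX (z : R[i]) n : cabs (z ^+ n) = cabs z ^+ n.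
Proof. by elim: n => [|n IH]; rewrite ?expr0 ?cabs1// !exprS cabsM IH. Qed.

Lemma conjM z w : conjc (z * w) = conjc z * conjc w.
Proof. exact: rmorphM. Qed.
Lemma conjD z w : conjc (z + w) = conjc z + conjc w.
Proof. exact: rmorphD. Qed.
Lemma conjB z w : conjc (z - w) = conjc z - conjc w.
Proof. exact: rmorphB. Qed.
Lemma conjX z n : conjc (z ^+ n) = conjc z ^+ n.
Proof. exact: rmorphXn. Qed.
Lemma conji : conjc ('i%C : R[i]) = - 'i%C.
Proof. by apply/eqP; rewrite eq_complex /= oppr0 !eqxx. Qed.
(* Inside ring operations [_^*] and ['i] parse as [Num.conj] and ['i%R] rather than as
   [conjc] and ['i%C]; these two lemmas move between the spellings. *)
Lemma num_conjE z : Num.conj z = conjc z.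
Proof. by []. Qed.
Lemma num_iE : 'i%R = 'i%C :> R[i].
Proof. by rewrite complexiE. Qed.

Lemma cabs_sqrC z : (cabs z ^+ 2)%:C = z * (conjc z).
Proof. by rewrite rmorphXn /= -normc_cabs sqr_normc. Qed.

(** The norm of [R[i]] is itself complex-valued, so its radii range over positive elements of
    [R[i]]; these are real, which lets every later limit be argued with the real modulus [cabs]. *)
Lemma cvgCP (T : Type) (FF : set_system T) (f : T -> R[i]) (l : R[i]) : Filter FF ->
  (f @ FF --> l) <-> (forall e : R, 0 < e -> \forall t \near FF, cabs (l - f t) < e).
Proof.
move=> FFF; split.
  move=> /(@cvgrPdist_lt R[i] R[i]^o T FF FFF f l) H e e0.
  have := H e%:C; rewrite ltcR => /(_ e0).
  by apply: filterS => t; rewrite normc_cabs ltcR.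
move=> H; apply/(@cvgrPdist_lt R[i] R[i]^o T FF FFF f l) => e e0.
have ee : e = (complex.Re e)%:C by rewrite RRe_real// ger0_real// ltW.
rewrite ee; apply: filterS (H (complex.Re e) _); last by rewrite -ltcR -ee.
by move=> t; rewrite normc_cabs ltcR.
Qed.

Lemma cvgC_creal (T : Type) (FF : set_system T) (f : T -> R[i]) (l : R[i]) : Filter FF ->
  f @ FF --> l -> creal (f t) @[t --> FF] --> creal l.
Proof.
move=> FFF /cvgCP H; apply/cvgrPdist_lt => e e0.
apply: filterS (H e e0) => t; apply: le_lt_trans.
by rewrite -crealB creal_le_cabs.
Qed.

Lemma cvgC_cimag (T : Type) (FF : set_system T) (f : T -> R[i]) (l : R[i]) : Filter FF ->
  f @ FF --> l -> cimag (f t) @[t --> FF] --> cimag l.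
Proof.
move=> FFF /cvgCP H; apply/cvgrPdist_lt => e e0.
apply: filterS (H e e0) => t; apply: le_lt_trans.
by rewrite -cimagB cimag_le_cabs.
Qed.

Lemma cvgC_lip (f : R[i] -> R[i]) (l : R[i]) (C d : R) :
  0 < d -> (forall h : R[i], h != 0 -> cabs h < d -> cabs (f h - l) <= C * cabs h) ->
  f @ 0^' --> l.
Proof.
move=> d0 H; apply/cvgCP => e e0.
(* The sign of [C] is not known; [|C| + 1] is a positive substitute that can be divided by. *)
have C1 : 0 < `|C| + 1 by rewrite ltr_wpDl.
pose r := Num.min d (e / (`|C| + 1)).
have r0 : 0 < r by rewrite lt_min d0 divr_gt0.
apply/nbhs_ballP; exists r%:C; first by rewrite /= ltcR.
move=> h; rewrite /ball/= sub0r normrN normc_cabs ltcR => hr h0.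
have [hd he] : cabs h < d /\ cabs h < e / (`|C| + 1).
  by move: hr; rewrite lt_min => /andP[].
rewrite cabsBC; apply: le_lt_trans (H _ h0 hd) _.
move: he; rewrite ltr_pdivlMr// => he; apply: le_lt_trans he.
rewrite mulrC ler_wpM2l ?cabs_ge0//; have := ler_norm C; lra.
Qed.

Lemma cvgR_lip (f : R -> R[i]) (l : R[i]) (C d : R) :
  0 < d -> (forall h : R, h != 0 -> `|h| < d -> cabs (f h - l) <= C * `|h|) ->
  f @ 0^' --> l.
Proof.
move=> d0 H; apply/cvgCP => e e0.
have C1 : 0 < `|C| + 1 by rewrite ltr_wpDl.
pose r := Num.min d (e / (`|C| + 1)).
have r0 : 0 < r by rewrite lt_min d0 divr_gt0.
apply/nbhs_ballP; exists r => //.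
move=> h; rewrite /ball/= sub0r normrN => hr h0.
have [hd he] : `|h| < d /\ `|h| < e / (`|C| + 1).
  by move: hr; rewrite lt_min => /andP[].
rewrite cabsBC; apply: le_lt_trans (H _ h0 hd) _.
move: he; rewrite ltr_pdivlMr// => he; apply: le_lt_trans he.
rewrite mulrC ler_wpM2l ?normr_ge0//; have := ler_norm C; lra.
Qed.

Lemma limC (f : R -> R[i]) l : f @ 0^' --> l -> lim (f @ 0^') = l.
Proof. move=> H. apply: cvg_lim => //. exact: (@norm_hausdorff _ R[i]^o). Qed.
End cpx.

(** * Complex integrals over the circle *)

Section cint.
Context {R : realType}.
Notation mu := (@lebesgue_measure R).
Notation I := (@I2pi R).
Implicit Types (phi psi : R -> R[i]) (z w : R[i]) (h : R -> R).

Lemma measurable_I2pi : measurable (I : set R).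
Proof. exact: measurable_itv. Qed.
Hint Resolve measurable_I2pi : core.

Lemma pi2_gt0 : 0 < pi *+ 2 :> R.
Proof. by rewrite mulrn_wgt0// pi_gt0. Qed.

Lemma mu_I2pi : mu I = (pi *+ 2)%:E.
Proof. by rewrite /I2pi lebesgue_measure_itv/= lte_fin pi2_gt0 sube0. Qed.

Lemma I2pi_bounded_integrable h (M : R) : measurable_fun I h ->
  (forall t, I t -> `|h t| <= M) -> mu.-integrable I (EFin \o h).
Proof.
move=> mh hM; apply: measurable_bounded_integrable => //.
  by rewrite [ltLHS]mu_I2pi ltry.
exists M; split; first exact: num_real.
by move=> x Mx t It /=; apply: le_trans (hM t It) (ltW Mx).
Qed.

Lemma I2pi_integrableZl (x : R) h : mu.-integrable I (EFin \o h) ->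
  mu.-integrable I (EFin \o (fun t => x * h t)).
Proof.
move=> ih; rewrite (_ : _ \o _ = (fun t => x%:E * (EFin \o h) t)%E); last first.
  by apply/funext => t; rewrite /= EFinM.
exact: integrableZl.
Qed.

(** Continuity is stated on the two real components because measurability and integrability are used
    in that form. *)
Definition ccont phi := continuous (fun t => creal (phi t)) /\ continuous (fun t => cimag (phi t)).

Lemma ccont_cst z : ccont (fun=> z).
Proof. by split; move=> t; exact: cvg_cst. Qed.

Lemma ccontB phi psi : ccont phi -> ccont psi -> ccont (fun t => phi t - psi t).
Proof.
move=> [c1 c2] [d1 d2]; split.
  under [X in continuous X]eq_fun do rewrite crealB.
  by move=> t; apply: cvgB; [exact: c1|exact: d1].
under [X in continuous X]eq_fun do rewrite cimagB.
by move=> t; apply: cvgB; [exact: c2|exact: d2].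
Qed.

Lemma ccontM phi psi : ccont phi -> ccont psi -> ccont (fun t => phi t * psi t).
Proof.
move=> [c1 c2] [d1 d2]; split.
  under [X in continuous X]eq_fun do rewrite crealM.
  move=> t; apply: cvgB; first by apply: cvgM; [exact: c1|exact: d1].
  by apply: cvgM; [exact: c2|exact: d2].
under [X in continuous X]eq_fun do rewrite cimagM.
move=> t; apply: cvgD; first by apply: cvgM; [exact: c1|exact: d2].
by apply: cvgM; [exact: c2|exact: d1].
Qed.

Lemma ccontV phi : ccont phi -> (forall t, phi t != 0) -> ccont (fun t => (phi t)^-1).
Proof.
move=> [c1 c2] p0.
have n0 t : creal (phi t) ^+ 2 + cimag (phi t) ^+ 2 != 0.
  by rewrite -cabs_sqr expf_neq0// cabs_eq0.
have cn : continuous (fun t => (creal (phi t) ^+ 2 + cimag (phi t) ^+ 2)^-1).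
  move=> t; apply: cvgV => //; apply: cvgD.
    by apply: cvgM; exact: c1.
  by apply: cvgM; exact: c2.
have rE t : creal (phi t)^-1 = creal (phi t) * (creal (phi t) ^+ 2 + cimag (phi t) ^+ 2)^-1.
  by case: (phi t).
have iE t : cimag (phi t)^-1 = - cimag (phi t) * (creal (phi t) ^+ 2 + cimag (phi t) ^+ 2)^-1.
  by case: (phi t) => a b /=; rewrite mulNr.
split.
  under [X in continuous X]eq_fun do rewrite rE.
  by move=> t; apply: cvgM; [exact: c1|exact: cn].
under [X in continuous X]eq_fun do rewrite iE.
move=> t; apply: cvgM; last exact: cn.
by apply: cvgN; exact: c2.
Qed.

Lemma ccont_expi : ccont (@expi R).
Proof. by split; [exact: continuous_cos|exact: continuous_sin]. Qed.

Lemma ccont_expiJ : ccont (fun t : R => (expi t)^*).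
Proof. by split; [exact: continuous_cos|move=> t; apply: cvgN; exact: continuous_sin]. Qed.

(** A class of integrands closed under sums and products and always integrable on the circle; it
    contains [F] and all the Cauchy kernels, so that linearity of [cint] applies freely. *)
Definition bmeas phi := [/\ measurable_fun I (fun t => creal (phi t)),
  measurable_fun I (fun t => cimag (phi t)) &
  exists M : R, forall t, I t -> cabs (phi t) <= M].

Lemma bmeas_ccont phi (M : R) : ccont phi -> (forall t, cabs (phi t) <= M) -> bmeas phi.
Proof.
move=> [c1 c2] H; split; last by exists M.
  by apply: measurable_funTS; exact: continuous_measurable_fun.
by apply: measurable_funTS; exact: continuous_measurable_fun.
Qed.

Lemma bmeasD phi psi : bmeas phi -> bmeas psi -> bmeas (fun t => phi t + psi t).
Proof.
move=> [m1 m2 [M HM]] [n1 n2 [N HN]]; split.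
- by under eq_fun do rewrite crealD; exact: measurable_funD.
- by under eq_fun do rewrite cimagD; exact: measurable_funD.
- by exists (M + N) => t It; apply: le_trans (cabsD _ _) _; rewrite lerD ?HM ?HN.
Qed.

Lemma bmeasM phi psi : bmeas phi -> bmeas psi -> bmeas (fun t => phi t * psi t).
Proof.
move=> [m1 m2 [M HM]] [n1 n2 [N HN]]; split.
- by under eq_fun do rewrite crealM; apply: measurable_funB; exact: measurable_funM.
- by under eq_fun do rewrite cimagM; apply: measurable_funD; exact: measurable_funM.
- by exists (M * N) => t It; rewrite cabsM ler_pM ?cabs_ge0 ?HM ?HN.
Qed.

Lemma bmeas_cst z : bmeas (fun=> z).
Proof. by apply: (@bmeas_ccont _ (cabs z)); [exact: ccont_cst|]. Qed.

Lemma bmeasB phi psi : bmeas phi -> bmeas psi -> bmeas (fun t => phi t - psi t).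
Proof.
move=> g1 g2; under eq_fun do rewrite -[X in _ + X]mulN1r.
by apply: bmeasD => //; apply: bmeasM => //; exact: bmeas_cst.
Qed.

Lemma bmeas_creal phi : bmeas phi -> mu.-integrable I (fun t => (creal (phi t))%:E).
Proof.
move=> [m1 _ [M HM]]; apply: (@I2pi_bounded_integrable _ M) => // t It.
exact: le_trans (creal_le_cabs _) (HM t It).
Qed.

Lemma bmeas_cimag phi : bmeas phi -> mu.-integrable I (fun t => (cimag (phi t))%:E).
Proof.
move=> [_ m1 [M HM]]; apply: (@I2pi_bounded_integrable _ M) => // t It.
exact: le_trans (cimag_le_cabs _) (HM t It).
Qed.

Definition cint phi : R[i] :=
  (\int[mu]_(t in I) creal (phi t)) +i* (\int[mu]_(t in I) cimag (phi t)).

Lemma eq_cint phi psi : (forall t, I t -> phi t = psi t) -> cint phi = cint psi.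
Proof.
by move=> H; rewrite /cint; congr (_ +i* _); apply: eq_Rintegral => t /set_mem It; rewrite H.
Qed.

Lemma cintD phi psi : bmeas phi -> bmeas psi ->
  cint (fun t => phi t + psi t) = cint phi + cint psi.
Proof.
move=> g1 g2; rewrite /cint -[RHS]/(_ +i* _); congr (_ +i* _).
  under eq_Rintegral do rewrite crealD.
  by rewrite RintegralD//; exact: bmeas_creal.
under eq_Rintegral do rewrite cimagD.
by rewrite RintegralD//; exact: bmeas_cimag.
Qed.

Lemma cintZ (c : R[i]) phi : bmeas phi -> cint (fun t => c * phi t) = c * cint phi.
Proof.
move=> g; have gr := bmeas_creal _ g; have gi := bmeas_cimag _ g.
case: c => a b; rewrite /cint -[RHS]/(_ +i* _); congr (_ +i* _).
  under eq_Rintegral do rewrite crealM /=.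
  by rewrite RintegralB ?RintegralZl//; exact: I2pi_integrableZl.
under eq_Rintegral do rewrite cimagM /=.
by rewrite RintegralD ?RintegralZl//; exact: I2pi_integrableZl.
Qed.

Lemma cintB phi psi : bmeas phi -> bmeas psi ->
  cint (fun t => phi t - psi t) = cint phi - cint psi.
Proof.
move=> g1 g2.
have -> : (fun t => phi t - psi t) = (fun t => phi t + (-1) * psi t).
  by apply/funext => t; rewrite mulN1r.
by rewrite cintD// ?cintZ ?mulN1r//; apply: bmeasM => //; exact: bmeas_cst.
Qed.

(** Each component contributes [2 pi M], hence [4 pi] in place of the sharp [2 pi]. *)
Lemma cint_le phi (M : R) : bmeas phi -> (forall t, I t -> cabs (phi t) <= M) ->
  cabs (cint phi) <= M * (pi *+ 4).
Proof.
move=> g HM; apply: le_trans (cabs_le _) _; rewrite /cint /=.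
have bnd (f : R -> R) : mu.-integrable I (EFin \o f) -> (forall t, I t -> `|f t| <= M) ->
   `|\int[mu]_(t in I) f t| <= M * (pi *+ 2).
  move=> intf fM; apply: le_trans (le_normr_Rintegral _ intf) _ => //.
  have -> : M * (pi *+ 2) = \int[mu]_(t in I) (cst M t).
    by rewrite Rintegral_cst// [X in fine X]mu_I2pi.
  apply: le_Rintegral => //.
    by move/integrable_abse : intf.
  by apply: (@I2pi_bounded_integrable _ `|M|) => //; exact: measurable_cst.
have -> : M * (pi *+ 4) = M * (pi *+ 2) + M * (pi *+ 2).
  by rewrite -mulrDr -mulrnDr.
apply: lerD; apply: bnd.
- exact: bmeas_creal.
- by move=> t It; apply: le_trans (creal_le_cabs _) (HM t It).
- exact: bmeas_cimag.
- by move=> t It; apply: le_trans (cimag_le_cabs _) (HM t It).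
Qed.
End cint.

(** * Cauchy transforms *)

(** Exact second-order Taylor remainder of the inverse, with the factor [k ^+ 2] displayed. It is
    meant for [a = 1 - z w] and [k = h w]; the exponent [1] and the factor [1%:R] fit the general
    pattern of [cauchyT_rem]. *)
Lemma inv_rem0 (K : fieldType) (a k : K) : a != 0 -> a - k != 0 ->
  (a - k)^-1 ^+ 1 - a^-1 ^+ 1 - 1%:R * k * a^-1 ^+ 2 = k ^+ 2 * (a^-1 ^+ 2 * (a - k)^-1).
Proof. by move=> a0 b0; field; rewrite a0 b0. Qed.

Lemma inv_rem1 (K : fieldType) (a k : K) : a != 0 -> a - k != 0 ->
  (a - k)^-1 ^+ 2 - a^-1 ^+ 2 - 2%:R * k * a^-1 ^+ 3 =
  k ^+ 2 * ((3 * a - 2 * k) * (a^-1 ^+ 3 * (a - k)^-1 ^+ 2)).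
Proof. by move=> a0 b0; field; rewrite a0 b0. Qed.

Section cauchy.
Context {R : realType}.
Notation I := (@I2pi R).
(** [w] will be [conjc (expi t)] for the analytic part of the Poisson integral and [expi t] for the
    anti-analytic one; the estimates use only its continuity and modulus one. *)
Variables (F w : R -> R[i]).
Hypothesis gF : bmeas F.
Hypothesis cw : ccont w.
Hypothesis w1 : forall t, cabs (w t) = 1.
Implicit Types z h : R[i].

Lemma le_cabs_1B z t : 1 - cabs z <= cabs (1 - z * w t).
Proof. by have := lecabs_sub 1 (z * w t); rewrite cabs1 cabsM w1 mulr1. Qed.

Lemma cabs_1B_neq0 z t : cabs z < 1 -> 1 - z * w t != 0.
Proof. by move=> z1; rewrite -cabs_gt0; have := le_cabs_1B z t; lra. Qed.

Lemma cabs_inv1B_le z t : cabs z < 1 -> cabs (1 - z * w t)^-1 <= (1 - cabs z)^-1.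
Proof.
move=> z1; rewrite cabsV lef_pV2 ?le_cabs_1B// posrE; first by rewrite cabs_gt0 cabs_1B_neq0.
by lra.
Qed.

Lemma bmeas_w : bmeas w.
Proof. by apply: (@bmeas_ccont _ _ 1) => // t; rewrite w1. Qed.

Lemma bmeas_inv1B z : cabs z < 1 -> bmeas (fun t => (1 - z * w t)^-1).
Proof.
move=> z1; apply: (@bmeas_ccont _ _ (1 - cabs z)^-1); last by move=> t; exact: cabs_inv1B_le.
apply: ccontV => [|t]; last exact: cabs_1B_neq0.
by apply: ccontB; [exact: ccont_cst|apply: ccontM => //; exact: ccont_cst].
Qed.

Lemma bmeasX (phi : R -> R[i]) n : bmeas phi -> bmeas (fun t => phi t ^+ n).
Proof.
move=> g; elim: n => [|n IH]; first by under eq_fun do rewrite expr0; exact: bmeas_cst.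
by under eq_fun do rewrite exprS; exact: bmeasM.
Qed.

(* [k]-th derivative of the Cauchy transform [z |-> \int F / (1 - z w)], divided by [k!] *)
Definition cauchyT k z : R[i] :=
  cint (fun t => F t * (w t ^+ k * (1 - z * w t)^-1 ^+ k.+1)).

Lemma bmeas_cauchy k z : cabs z < 1 ->
  bmeas (fun t => F t * (w t ^+ k * (1 - z * w t)^-1 ^+ k.+1)).
Proof.
move=> z1; apply: bmeasM => //; apply: bmeasM; apply: bmeasX; first exact: bmeas_w.
exact: bmeas_inv1B.
Qed.

Lemma cauchyT_le k : exists2 M : R, 0 <= M & forall z, cabs z < 1 ->
  cabs (cauchyT k z) <= M * (1 - cabs z)^-1 ^+ k.+1.
Proof.
have [_ _ [M HM]] := gF.
have M0 : 0 <= M.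
  by apply: le_trans (cabs_ge0 (F 0)) (HM _ _); rewrite /I2pi/= in_itv/= lexx ltW ?pi2_gt0.
exists (M * (pi *+ 4)) => [|z z1]; first by rewrite mulr_ge0// mulrn_wge0// pi_ge0.
rewrite mulrAC; apply: cint_le => [|t It]; first exact: bmeas_cauchy.
rewrite cabsM ler_pM ?cabs_ge0 ?HM// cabsM cabsX w1 expr1n mul1r cabsX lerXn2r ?nnegrE ?cabs_ge0//.
  by rewrite invr_ge0; lra.
exact: cabs_inv1B_le.
Qed.

(** A Taylor remainder of the kernel that is uniform in [t] integrates to one of the transform. The
    factor [c] will be [k.+1]. Keeping [h] below half the distance from [z] to the circle keeps
    [z + h] uniformly inside the disk. *)
Lemma cauchyT_rem k (c : nat) z : cabs z < 1 ->
  (exists C : R, forall h t, cabs h < (1 - cabs z) / 2 ->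
     cabs ((1 - (z + h) * w t)^-1 ^+ k.+1 - (1 - z * w t)^-1 ^+ k.+1
       - c%:R * (h * w t) * (1 - z * w t)^-1 ^+ k.+2) <= C * cabs h ^+ 2) ->
  exists C : R, forall h, cabs h < (1 - cabs z) / 2 ->
  cabs (cauchyT k (z + h) - cauchyT k z - h * (c%:R * cauchyT k.+1 z)) <= C * cabs h ^+ 2.
Proof.
move=> z1 [C HC]; have [_ _ [M HM]] := gF.
exists (M * C * (pi *+ 4)) => h hd.
have zh : cabs (z + h) < 1 by have := cabsD z h; lra.
have g1 := bmeas_cauchy k _ zh; have g2 := bmeas_cauchy k _ z1.
have g3 := bmeas_cauchy k.+1 _ z1; have g4 := bmeasM _ _ (bmeas_cst (h * c%:R)) g3.
rewrite mulrA /cauchyT -(cintZ _ _ g3) -(cintB _ _ g1 g2) -(cintB _ _ (bmeasB _ _ g1 g2) g4).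
rewrite [leRHS]mulrAC; apply: cint_le; first exact: bmeasB (bmeasB _ _ g1 g2) g4.
move=> t It.
set X1 := (1 - (z + h) * w t)^-1 ^+ _; set X2 := (1 - z * w t)^-1 ^+ k.+1.
set X3 := (1 - z * w t)^-1 ^+ _.
rewrite (_ : _ - _ - _ = F t * (w t ^+ k * (X1 - X2 - c%:R * (h * w t) * X3))).
  rewrite cabsM -[leRHS]mulrA ler_pM ?cabs_ge0 ?HM// cabsM cabsX w1 expr1n mul1r.
  exact: HC.
by rewrite exprS; ring.
Qed.

Lemma cauchyT0_rem z : cabs z < 1 -> exists C : R, forall h, cabs h < (1 - cabs z) / 2 ->
  cabs (cauchyT 0 (z + h) - cauchyT 0 z - h * (1%:R * cauchyT 1 z)) <= C * cabs h ^+ 2.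
Proof.
move=> z1; apply: cauchyT_rem => //.
pose d := (1 - cabs z)^-1; have d0 : 0 <= d by rewrite invr_ge0; lra.
(* The inverse at [z] is at most [d]; the one at [z + h] is at most [2 d], since [1 - cabs (z + h)]
   is at least half of [1 - cabs z]. *)
exists (d ^+ 2 * (2 * d)) => h t hd.
have zh : cabs (z + h) < 1 by have := cabsD z h; lra.
have bE : 1 - (z + h) * w t = 1 - z * w t - h * w t by ring.
have := cabs_1B_neq0 _ t zh; have := cabs_inv1B_le _ t zh; rewrite bE => b1 b0.
rewrite inv_rem0//; last exact: cabs_1B_neq0.
rewrite cabsM cabsX cabsM w1 mulr1 mulrC ler_wpM2r ?exprn_ge0 ?cabs_ge0//.
rewrite cabsM cabsX ler_pM ?exprn_ge0 ?cabs_ge0//.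
  by rewrite lerXn2r ?nnegrE ?cabs_ge0//; exact: cabs_inv1B_le.
apply: le_trans b1 _; rewrite /d -[leRHS]invrK invfM invrK.
by rewrite lef_pV2 ?posrE; have := cabsD z h; lra.
Qed.

Lemma cauchyT1_rem z : cabs z < 1 -> exists C : R, forall h, cabs h < (1 - cabs z) / 2 ->
  cabs (cauchyT 1 (z + h) - cauchyT 1 z - h * (2%:R * cauchyT 2 z)) <= C * cabs h ^+ 2.
Proof.
move=> z1; apply: cauchyT_rem => //.
pose d := (1 - cabs z)^-1; have d0 : 0 <= d by rewrite invr_ge0; lra.
(* The [8] bounds [3 a - 2 k]: here [|a| <= 2] and [|k| < 1/2]. *)
exists (8 * (d ^+ 3 * (2 * d) ^+ 2)) => h t hd.
have zh : cabs (z + h) < 1 by have := cabsD z h; lra.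
have bE : 1 - (z + h) * w t = 1 - z * w t - h * w t by ring.
have := cabs_1B_neq0 _ t zh; have := cabs_inv1B_le _ t zh; rewrite bE => b1 b0.
rewrite inv_rem1//; last exact: cabs_1B_neq0.
rewrite cabsM cabsX cabsM w1 mulr1 mulrC ler_wpM2r ?exprn_ge0 ?cabs_ge0//.
have cz0 := cabs_ge0 z; have ch0 := cabs_ge0 h.
have c2 n : cabs (n%:R : R[i]) = n%:R by rewrite -(rmorph_nat (real_complex R)) cabs_real ger0_norm.
rewrite cabsM ler_pM ?cabs_ge0//.
  apply: le_trans (cabsB _ _) _; rewrite !cabsM !c2 w1.
  have := cabsB 1 (z * w t); rewrite cabs1 cabsM w1; lra.
rewrite cabsM !cabsX ler_pM ?exprn_ge0 ?cabs_ge0//.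
  by rewrite lerXn2r ?nnegrE ?cabs_ge0//; exact: cabs_inv1B_le.
rewrite lerXn2r ?nnegrE ?cabs_ge0//; first by rewrite mulr_ge0.
apply: le_trans b1 _; rewrite /d -[leRHS]invrK invfM invrK.
by rewrite lef_pV2 ?posrE; have := cabsD z h; lra.
Qed.

End cauchy.

(** * Wirtinger derivatives of the Poisson integral *)

Section poisson_derivatives.
Context {R : realType}.
Notation I := (@I2pi R).
Variables (F : R -> R[i]).
Hypothesis gF : bmeas F.
Implicit Types z h : R[i].

Let w1 (t : R) : R[i] := conjc (expi t).
Let w2 (t : R) : R[i] := expi t.
Let cw1 : ccont w1. Proof. exact: ccont_expiJ. Qed.
Let cw2 : ccont w2. Proof. exact: ccont_expi. Qed.
Let aw1 t : cabs (w1 t) = 1. Proof. by rewrite cabsJ cabs_expi. Qed.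
Let aw2 t : cabs (w2 t) = 1. Proof. exact: cabs_expi. Qed.
Let c : R[i] := ((pi *+ 2)^-1)%:C.
Let T k := cauchyT F w1 k.
Let S k := cauchyT F w2 k.
Let conjw t : conjc (w1 t) = w2 t. Proof. exact: conjcK. Qed.
Notation f := (poisson_integral F).

(** With [a = 1 - z w1] and [b] its conjugate, the bracket is [(a + b - a b) / (a b)]. The
    denominator is [|a|^2] and the numerator is [1 - (1 - a) (1 - b) = 1 - |z|^2]. *)
Lemma poisson_kernel_cauchy z t : cabs z < 1 ->
  (poisson_kernel z t)%:C = c * ((1 - z * w1 t)^-1 + (1 - (conjc z) * w2 t)^-1 - 1).
Proof.
move=> z1; rewrite /poisson_kernel rmorphM /= num_conjE; congr (_ * _).
rewrite -/(w1 t) fmorph_div rmorphB rmorph1 /= !cabs_sqrC.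
rewrite conjB conjM conjc1 conjw.
have a0 : 1 - z * w1 t != 0 by exact: cabs_1B_neq0.
have b0 : 1 - (conjc z) * w2 t != 0 by apply: cabs_1B_neq0 => //; rewrite cabsJ.
have w0 : w1 t * w2 t = 1 by rewrite mulrC /w1 -cabs_sqrC cabs_expi expr1n.
apply: (mulIf (mulf_neq0 a0 b0)); rewrite divfK ?mulf_neq0//.
have -> (a b : R[i]) : a != 0 -> b != 0 -> (a^-1 + b^-1 - 1) * (a * b) = a + b - a * b.
  by move=> a1 b1; field; rewrite a1 b1.
have -> : z * (conjc z) = z * (conjc z) * (w1 t * w2 t) by rewrite w0 mulr1.
- ring.
- exact: a0.
- exact: b0.
Qed.

Lemma poisson_integral_cauchy z : cabs z < 1 ->
  f z = c * (T 0 z + S 0 (conjc z) - cint F).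
Proof.
move=> z1; have z1' : cabs (conjc z) < 1 by rewrite cabsJ.
have g1 := bmeas_cauchy _ _ gF cw1 aw1 0 _ z1; have g2 := bmeas_cauchy _ _ gF cw2 aw2 0 _ z1'.
rewrite /T /S /cauchyT -(cintD _ _ g1 g2) -(cintB _ _ (bmeasD _ _ g1 g2) gF).
rewrite -cintZ; last exact: bmeasB (bmeasD _ _ g1 g2) gF.
transitivity (cint (fun t => (poisson_kernel z t)%:C * F t)).
  rewrite /cint [RHS]complexE /= /poisson_integral num_iE; congr (_%:C + _ * _%:C).
    by apply: eq_Rintegral => t _; rewrite crealM /= mul0r subr0.
  by apply: eq_Rintegral => t _; rewrite cimagM /= mul0r addr0.
apply: eq_cint => t _; rewrite poisson_kernel_cauchy//; ring.
Qed.

(** One expansion serves both partial derivatives: [u = 1] gives the one in [x], [u = i] the one in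
    [y]. The anti-analytic part is displaced by the conjugate of [u t]. *)
Lemma poisson_integral_dir z (u : R[i]) : cabs z < 1 -> cabs u = 1 ->
  (fun t : R => (f (z + u * t%:C) - f z) / t%:C) @ 0^' --> c * (u * T 1 z + (conjc u) * S 1 (conjc z)).
Proof.
move=> z1 u1; have z1' : cabs (conjc z) < 1 by rewrite cabsJ.
have [C1 H1] := cauchyT0_rem _ _ gF cw1 aw1 _ z1.
have [C2 H2] := cauchyT0_rem _ _ gF cw2 aw2 _ z1'.
apply: (@cvgR_lip _ _ _ (cabs c * (C1 + C2)) ((1 - cabs z) / 2)); first by lra.
move=> t t0 td.
have ut : cabs (u * t%:C) = `|t| by rewrite cabsM u1 cabs_real mul1r.
have ut' : cabs ((conjc u) * t%:C) = `|t| by rewrite cabsM cabsJ u1 cabs_real mul1r.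
have zt : cabs (z + u * t%:C) < 1 by have := cabsD z (u * t%:C); lra.
have := H1 (u * t%:C); rewrite ut => /(_ td) {}H1.
have := H2 ((conjc u) * t%:C); rewrite ut' cabsJ => /(_ td) {}H2.
rewrite !poisson_integral_cauchy// conjD conjM conjc_real.
rewrite -/(T 0) -/(S 0) -/(T 1) -/(S 1) in H1 H2.
set T' := T 0 (z + _) in H1 *; set S' := S 0 ((conjc z) + _) in H2 *.
have tC : t%:C != 0 :> R[i] by rewrite fmorph_eq0.
rewrite (_ : _ - _ = c * ((T' - T 0 z - u * t%:C * (1%:R * T 1 z)) +
     (S' - S 0 (conjc z) - (conjc u) * t%:C * (1%:R * S 1 (conjc z)))) / t%:C); last by move: (c) => k; field.
rewrite cabsM cabsV cabs_real ler_pdivrMr ?normr_gt0// cabsM -[leRHS]mulrA -[leRHS]mulrA.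
apply: ler_wpM2l; first exact: cabs_ge0.
apply: le_trans (cabsD _ _) _; rewrite -expr2; lra.
Qed.

Lemma pdx_poisson z : cabs z < 1 -> pdx f z = c * (T 1 z + S 1 (conjc z)).
Proof.
move=> z1; apply: limC; have := poisson_integral_dir _ _ z1 cabs1.
by rewrite conjc1 !mul1r; under eq_fun do rewrite mul1r.
Qed.

Lemma pdy_poisson z : cabs z < 1 -> pdy f z = c * ('i%C * T 1 z - 'i%C * S 1 (conjc z)).
Proof.
move=> z1; apply: limC; have := poisson_integral_dir _ _ z1 cabs_i.
by rewrite conji mulNr /dquot_y num_iE.
Qed.

Lemma dz_poisson z : cabs z < 1 -> dz f z = c * T 1 z.
Proof.
move=> z1; rewrite /dz num_iE pdx_poisson// pdy_poisson//.
have i2 : 'i%C * 'i%C = -1 :> R[i] by rewrite -expr2 sqr_i.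
have -> : c * (T 1 z + S 1 (conjc z)) - 'i%C * (c * ('i%C * T 1 z - 'i%C * S 1 (conjc z))) =
  c * (T 1 z + S 1 (conjc z)) - ('i%C * 'i%C) * (c * (T 1 z - S 1 (conjc z))) by ring.
by rewrite i2; move: (c) => k; field.
Qed.

Lemma dzbar_poisson z : cabs z < 1 -> dzbar f z = c * S 1 (conjc z).
Proof.
move=> z1; rewrite /dzbar num_iE pdx_poisson// pdy_poisson//.
have i2 : 'i%C * 'i%C = -1 :> R[i] by rewrite -expr2 sqr_i.
have -> : c * (T 1 z + S 1 (conjc z)) + 'i%C * (c * ('i%C * T 1 z - 'i%C * S 1 (conjc z))) =
  c * (T 1 z + S 1 (conjc z)) + ('i%C * 'i%C) * (c * (T 1 z - S 1 (conjc z))) by ring.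
by rewrite i2; move: (c) => k; field.
Qed.

Lemma analytic_dz_poisson : analytic_on_disk (dz f).
Proof.
move=> z; rewrite /Disk /= => z1.
have [C H] := cauchyT1_rem _ _ gF cw1 aw1 _ z1.
exists (c * (2%:R * T 2 z)).
apply: (@cvgC_lip _ _ _ (cabs c * C) ((1 - cabs z) / 2)); first by lra.
move=> h h0 hd; have := H h hd => {}H.
have zh : cabs (z + h) < 1 by have := cabsD z h; lra.
rewrite !dz_poisson//.
rewrite (_ : _ - _ = c * (T 1 (z + h) - T 1 z - h * (2%:R * T 2 z)) / h); last by move: (c) => k; field.
have ch : 0 < cabs h by rewrite cabs_gt0.
rewrite cabsM cabsV ler_pdivrMr // cabsM -!mulrA.
by apply: ler_wpM2l; [exact: cabs_ge0|rewrite -expr2].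
Qed.

Lemma analytic_dzbar_poisson : analytic_on_disk (fun z => conjc (dzbar f z)).
Proof.
move=> z; rewrite /Disk /= => z1; have z1' : cabs (conjc z) < 1 by rewrite cabsJ.
have [C H] := cauchyT1_rem _ _ gF cw2 aw2 _ z1'.
exists (conjc (c * (2%:R * S 2 (conjc z)))).
apply: (@cvgC_lip _ _ _ (cabs c * C) ((1 - cabs z) / 2)); first by lra.
move=> h h0 hd; have := H (conjc h); rewrite !cabsJ => /(_ hd) {}H.
have zh : cabs (z + h) < 1 by have := cabsD z h; lra.
rewrite !dzbar_poisson// -[h in _ / h]conjcK -conjc_inv -!(conjM, conjB) cabsJ conjD.
have hC : (conjc h) != 0 by rewrite conjc_eq0.
rewrite (_ : _ - _ = c * (S 1 ((conjc z) + (conjc h)) - S 1 (conjc z) - (conjc h) * (2%:R * S 2 (conjc z))) / (conjc h)); last by move: (c) => k; field.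
have ch : 0 < cabs h by rewrite cabs_gt0.
rewrite cabsM cabsV cabsJ ler_pdivrMr // cabsM -!mulrA.
by apply: ler_wpM2l; [exact: cabs_ge0|rewrite -expr2].
Qed.

(** On the half-radius disk [(1 - cabs z)^-2] is at most [4], so both first-order Cauchy transforms
    are bounded. This covers the region where dividing by [|z|] fails. *)
Lemma normD_poisson_bounded : exists M : R, forall z, cabs z <= 2^-1 -> normD f z <= M.
Proof.
have [M1 M10 H1] := cauchyT_le _ _ gF cw1 aw1 1; have [M2 M20 H2] := cauchyT_le _ _ gF cw2 aw2 1.
exists (cabs c * (M1 * 4) + cabs c * (M2 * 4)) => z z2.
have z1 : cabs z < 1 by lra. have z1' : cabs (conjc z) < 1 by rewrite cabsJ.
rewrite /normD dz_poisson// dzbar_poisson// !cabsM.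
have le4 : (1 - cabs z)^-1 ^+ 2 <= 4.
  rewrite (_ : 4 = 2 ^+ 2 :> R); last by rewrite -natrX.
  rewrite lerXn2r ?nnegrE ?invr_ge0//; first by lra.
  by rewrite -[leRHS]invrK lef_pV2 ?posrE; lra.
apply: lerD; apply: ler_wpM2l; rewrite ?cabs_ge0//.
  by apply: le_trans (H1 _ z1) _; rewrite ler_wpM2l.
by apply: le_trans (H2 _ z1') _; rewrite cabsJ ler_wpM2l.
Qed.

(** The kernel is twice the imaginary part, times [i], of the Koebe function [s / (1 - s)^2] at
    [s = z w1]; [dpoisson_cauchy] recognizes it as the angular derivative of the Poisson kernel. *)
Lemma dz_dzbar_poisson z : cabs z < 1 ->
  z * dz f z - (conjc z) * dzbar f z =
  c * cint (fun t => F t * (z * w1 t * (1 - z * w1 t)^-1 ^+ 2 -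
    conjc (z * w1 t * (1 - z * w1 t)^-1 ^+ 2))).
Proof.
move=> z1; have z1' : cabs (conjc z) < 1 by rewrite cabsJ.
have g1 := bmeas_cauchy _ _ gF cw1 aw1 1 _ z1; have g2 := bmeas_cauchy _ _ gF cw2 aw2 1 _ z1'.
rewrite dz_poisson// dzbar_poisson// mulrCA [(conjc z) * _]mulrCA -mulrBr; congr (_ * _).
rewrite /T /S /cauchyT -!cintZ// -cintB; last 2 first.
- by apply: bmeasM => //; exact: bmeas_cst.
- by apply: bmeasM => //; exact: bmeas_cst.
apply: eq_cint => t _.
rewrite conjM conjX conjc_inv conjB conjc1 !conjM conjw; ring.
Qed.

End poisson_derivatives.

(** * Integration by parts *)

Section ac_facts.
Context {R : realType}.
Notation mu := (@lebesgue_measure R).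
Notation I := (@I2pi R).

Lemma abs_cont_creal (a b : R) (F : R -> R[i]) : abs_cont_on a b F ->
  rabs_cont R a b (fun t => creal (F t)).
Proof.
move=> acF e e0; have [d d0 H] := acF e e0; exists d => // n s t st no lst.
apply: le_lt_trans (H n s t st no lst); apply: ler_sum => i _.
by rewrite -crealB creal_le_cabs.
Qed.

Lemma abs_cont_cimag (a b : R) (F : R -> R[i]) : abs_cont_on a b F ->
  rabs_cont R a b (fun t => cimag (F t)).
Proof.
move=> acF e e0; have [d d0 H] := acF e e0; exists d => // n s t st no lst.
apply: le_lt_trans (H n s t st no lst); apply: ler_sum => i _.
by rewrite -cimagB cimag_le_cabs.
Qed.

Lemma rabs_cont_continuous (a b : R) (h : R -> R) : rabs_cont R a b h ->
  {within `[a, b], continuous h}.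
Proof.
move=> ach; apply/subspace_continuousP => x /=; rewrite in_itv/= => /andP[ax xb].
apply/cvgrPdist_lt => e e0; have [d d0 H] := ach e e0.
rewrite near_withinE; apply/nbhs_ballP; exists d => // y; rewrite /ball /= => xy.
rewrite in_itv/= => /andP[ay yb].
have [le_xy|lt_yx] := leP x y.
  have := H 1%N (fun=> x) (fun=> y); rewrite !big_ord1 distrC; apply.
  - by move=> _.
  - by move=> i j; rewrite !ord1.
  - by move: xy; rewrite ler0_norm ?subr_le0//; lra.
have := H 1%N (fun=> y) (fun=> x); rewrite !big_ord1; apply.
- by move=> _; split => //; split => //; exact: ltW.
- by move=> i j; rewrite !ord1.
- by move: xy; rewrite gtr0_norm ?subr_gt0//; lra.
Qed.

Lemma within_continuous_bounded (a b : R) (h : R -> R) : a <= b ->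
  {within `[a, b], continuous h} -> exists M : R, forall t, `[a, b]%classic t -> `|h t| <= M.
Proof.
move=> ab ch; have [c1 _ H1] := EVT_max ab ch; have [c2 _ H2] := EVT_min ab ch.
exists (`|h c1| + `|h c2|) => t tab.
have := H1 t tab; have := H2 t tab; have := ler_norm (h c1); have := lerNnormlW (lexx `|h c2|).
have := normr_ge0 (h c1); have := normr_ge0 (h c2).
rewrite ler_norml; lra.
Qed.

Lemma abs_cont_good (F : R -> R[i]) : abs_cont_on 0 (pi *+ 2) F -> bmeas F.
Proof.
move=> acF.
have cr := rabs_cont_continuous _ _ _ (abs_cont_creal _ _ _ acF).
have ci := rabs_cont_continuous _ _ _ (abs_cont_cimag _ _ _ acF).
have p0 := ltW (@pi2_gt0 R).
split.
- by apply: subspace_continuous_measurable_fun => //; exact: measurable_I2pi.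
- by apply: subspace_continuous_measurable_fun => //; exact: measurable_I2pi.
have [M1 H1] := within_continuous_bounded _ _ _ p0 cr.
have [M2 H2] := within_continuous_bounded _ _ _ p0 ci.
exists (M1 + M2) => t It; apply: le_trans (cabs_le _) _.
by apply: lerD; [exact: H1|exact: H2].
Qed.

(** An increment of [q h] splits as [q (t) dh + h (s) dq]. The first terms are controlled by the
    absolute continuity of [h], the second by the total length, each up to half of [e]. *)
Lemma rabs_contM_lip (a b L M : R) (q h : R -> R) :
  rabs_cont R a b h ->
  (forall x, a <= x <= b -> `|q x| <= M) ->
  (forall x, a <= x <= b -> `|h x| <= M) ->
  (forall x y, a <= x -> x <= y -> y <= b -> `|q y - q x| <= L * (y - x)) ->
  rabs_cont R a b (fun x => q x * h x).
Proof.
move=> ach qM hM qL e e0.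
pose M' := `|M| + 1; pose L' := `|L| + 1.
have M'0 : 0 < M' by rewrite ltr_wpDl.
have L'0 : 0 < L' by rewrite ltr_wpDl.
have MM' : M <= M' by rewrite /M'; have := ler_norm M; lra.
have LL' : L <= L' by rewrite /L'; have := ler_norm L; lra.
have e1 : 0 < e / (2 * M') by rewrite divr_gt0// mulr_gt0.
have [d d0 H] := ach _ e1.
exists (Num.min d (e / (2 * (M' * L')))).
  by rewrite lt_min d0 divr_gt0// !mulr_gt0.
move=> n s t st no; rewrite lt_min => /andP[lst1 lst2].
have S1 := H n s t st no lst1.
apply: le_lt_trans (_ : _ <= M' * \sum_(i < n) `|h (t i) - h (s i)| +
   (M' * L') * \sum_(i < n) (t i - s i)) _.
  rewrite !mulr_sumr -big_split /=; apply: ler_sum => i _.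
  have [ai [si ti]] := st i.
  rewrite (_ : _ - _ = q (t i) * (h (t i) - h (s i)) + h (s i) * (q (t i) - q (s i))); last by ring.
  apply: le_trans (ler_normD _ _) _; rewrite !normrM -mulrA; apply: lerD.
    by apply: ler_wpM2r => //; apply: le_trans (qM _ _) MM'; lra.
  apply: ler_pM => //; first by apply: le_trans (hM _ _) MM'; lra.
  by apply: le_trans (qL _ _ ai si ti) _; apply: ler_wpM2r => //; lra.
move: S1 lst2; rewrite !ltr_pdivlMr ?mulr_gt0//; lra.
Qed.

Lemma integrable_bounded_mul (q g : R -> R) (M : R) : measurable_fun I q ->
  (forall t, I t -> `|q t| <= M) -> mu.-integrable I (EFin \o g) ->
  mu.-integrable I (EFin \o (fun t => q t * g t)).
Proof.
move=> mq qM ig.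
have iM : mu.-integrable I (fun t => M%:E * `|(EFin \o g) t|)%E.
  by apply: integrableZl; [exact: measurable_I2pi|exact: integrable_abse].
apply: le_integrable iM; first exact: measurable_I2pi.
  apply/measurable_EFinP; apply: measurable_funM => //.
  by apply/measurable_EFinP; exact: (measurable_int _ ig).
move=> t It /=; rewrite lee_fin normrM normrM normr_id ler_wpM2r//.
exact: le_trans (qM t It) (ler_norm M).
Qed.

(** The fundamental theorem is applied to [q h], which is absolutely continuous because [q] is
    Lipschitz by the mean value theorem; the boundary term disappears since [q] and [h] agree at the
    two ends. *)
Lemma periodic_by_parts (q q' h g : R -> R) (M : R) :
  (forall t : R, is_derive t (1 : R) q (q' t)) -> measurable_fun I q' ->
  (forall t, `|q t| <= M) -> (forall t, `|q' t| <= M) ->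
  q (pi *+ 2) = q 0 -> h (pi *+ 2) = h 0 ->
  rabs_cont R 0 (pi *+ 2) h -> mu.-integrable I (EFin \o g) ->
  {ae mu, forall t, 0 < t < pi *+ 2 -> (fun e => (h (t + e) - h t) / e) @ 0^' --> g t} ->
  \int[mu]_(t in I) (q' t * h t) = - \int[mu]_(t in I) (q t * g t).
Proof.
move=> dq mq' qM q'M qp hp ach ig dh.
have p0 := ltW (@pi2_gt0 R).
have cq : continuous q.
  by move=> t; apply: differentiable_continuous; apply/derivable1_diffP; exact: (@ex_derive _ _ _ _ _ _ _ (dq t)).
have qL x y : 0 <= x -> x <= y -> y <= pi *+ 2 -> `|q y - q x| <= M * (y - x).
  move=> _ xy _.
  have [c _ ->] := @MVT_segment R q q' x y xy (fun t _ => dq t) (continuous_subspaceT cq).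
  by rewrite normrM (ger0_norm (_ : 0 <= y - x)) ?subr_ge0// ler_wpM2r// subr_ge0.
have ch := rabs_cont_continuous _ _ _ ach.
have [M2 hM] := within_continuous_bounded _ _ _ p0 ch.
have M0 : 0 <= M by exact: le_trans (normr_ge0 _) (qM 0).
have M20 : 0 <= M2.
  by apply: le_trans (normr_ge0 _) (hM 0 _); rewrite /= in_itv/= lexx.
have acqh : rabs_cont R 0 (pi *+ 2) (fun t => q t * h t).
  apply: (@rabs_contM_lip _ _ M (M + M2)) => //.
  - by move=> x _; have := qM x; lra.
  - by move=> x xI; have := hM x; rewrite /= in_itv/= xI => /(_ isT); lra.
have mh : measurable_fun I h.
  by apply: subspace_continuous_measurable_fun => //; exact: measurable_I2pi.
have i1 : mu.-integrable I (EFin \o (fun t => q' t * h t)).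
  apply: (@integrable_bounded_mul _ _ M) => //.
  by apply: (@I2pi_bounded_integrable _ _ M2).
have i2 : mu.-integrable I (EFin \o (fun t => q t * g t)).
  apply: (@integrable_bounded_mul _ _ M) => //.
  by apply: measurable_funTS; exact: continuous_measurable_fun.
have i12 : mu.-integrable I (EFin \o (fun t => q' t * h t + q t * g t)).
  by apply: (integrableD _ i1 i2); exact: measurable_I2pi.
have := rabs_cont_FTC2 R _ _ _ _ p0 acqh i12.
rewrite -[X in \int[mu]_(t in X) _]/I RintegralD//; last exact: measurable_I2pi.
rewrite qp hp subrr => H; apply/eqP; rewrite -addr_eq0; apply/eqP; apply: H.
have aeF := ae_filter_ringOfSetsType mu.
apply: filterS dh => t dht tI.
have c1 : (fun e => (h (t + e) - h t) / e) @ 0^' --> g t by exact: dht.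
have c2 : (fun e => (q (t + e) - q t) / e) @ 0^' --> q' t.
  have [dqt <-] := dq t.
  have -> : (fun e => (q (t + e) - q t) / e) = (fun e => e^-1 *: (q (e *: 1 + t) - q t)).
    by apply/funext => e; rewrite /GRing.scale/= mulr1 (addrC e) mulrC.
  exact: dqt.
have c3 : (fun e => q (t + e)) @ 0^' --> q t.
  apply: cvg_within_filter.
  have : q \o (fun e => t + e) @ 0 --> q (t + 0).
    by apply: continuous_comp; [apply: cvgD; [exact: cvg_cst|exact: cvg_id]|exact: cq].
  by rewrite addr0.
have -> : (fun e => (q (t + e) * h (t + e) - q t * h t) / e) =
   (fun e => (q (t + e) - q t) / e * h t + q (t + e) * ((h (t + e) - h t) / e)).
  by apply/funext => e; ring.
by apply: cvgD; [apply: cvgM => //; exact: cvg_cst|exact: cvgM].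
Qed.

End ac_facts.

(** * The Poisson kernel *)

Section poisson_kernel_facts.
Context {R : realType}.
Notation mu := (@lebesgue_measure R).
Notation I := (@I2pi R).
Let c : R := (pi *+ 2)^-1.
Implicit Types (z : R[i]) (t : R).

(** The denominator of the kernel in real trigonometric form, ready to be differentiated in [t]. *)
Definition pden z t : R := 1 - 2 * (creal z * cos t + cimag z * sin t) + cabs z ^+ 2.

Lemma pdenE z t : cabs (1 - z * conjc (expi t)) ^+ 2 = pden z t.
Proof.
rewrite cabs_sqr /pden cabs_sqr; case: z => a b /=.
rewrite (_ : a ^+ 2 + b ^+ 2 = (a ^+ 2 + b ^+ 2) * (cos t ^+ 2 + sin t ^+ 2)); last by rewrite cos2Dsin2 mulr1.
ring.
Qed.

Lemma poisson_kernelE z t : poisson_kernel z t = c * (1 - cabs z ^+ 2) * (pden z t)^-1.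
Proof. by rewrite /poisson_kernel num_conjE pdenE mulrA. Qed.

Lemma pden_ge z t : cabs z < 1 -> (1 - cabs z) ^+ 2 <= pden z t.
Proof.
move=> z1; rewrite -pdenE lerXn2r ?nnegrE ?cabs_ge0//; first by lra.
by apply: (@le_cabs_1B R (fun t => conjc (expi t))) => {}t; rewrite cabsJ cabs_expi.
Qed.

Lemma pden_gt0 z t : cabs z < 1 -> 0 < pden z t.
Proof. by move=> z1; apply: lt_le_trans (pden_ge _ t z1); rewrite exprn_gt0//; lra. Qed.

Lemma c_gt0 : 0 < c. Proof. by rewrite invr_gt0 pi2_gt0. Qed.

Lemma poisson_kernel_ge0 z t : cabs z < 1 -> 0 <= poisson_kernel z t.
Proof.
move=> z1; rewrite poisson_kernelE mulr_ge0 ?invr_ge0 ?(ltW (pden_gt0 _ _ z1))//.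
rewrite mulr_ge0 ?(ltW c_gt0)// subr_ge0 expr_le1 ?cabs_ge0//; exact: ltW.
Qed.

Definition dpoisson z t : R :=
  c * (1 - cabs z ^+ 2) * (- (2 * (creal z * sin t - cimag z * cos t)) * (pden z t)^-1 ^+ 2).

Lemma is_derive_poisson z t : cabs z < 1 ->
  is_derive t (1 : R) (poisson_kernel z) (dpoisson z t).
Proof.
move=> z1; have d0 := pden_gt0 _ t z1.
have -> : poisson_kernel z = (fun t => c * (1 - cabs z ^+ 2) * (pden z t)^-1).
  by apply/funext => s; rewrite poisson_kernelE.
have dd : is_derive t (1 : R) (pden z) (2 * (creal z * sin t - cimag z * cos t)).
  rewrite /pden; apply: is_derive_eq; rewrite /GRing.scale /=; ring.
have d1 : is_derive t (1 : R) (fun t => (pden z t)^-1)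
   (- (pden z t) ^- 2 *: (2 * (creal z * sin t - cimag z * cos t))).
  by apply: is_deriveV; rewrite gt_eqF.
apply: is_derive_eq; rewrite /dpoisson /GRing.scale /= exprVn; ring.
Qed.

Lemma continuous_pden z : continuous (pden z).
Proof.
move=> t; rewrite /pden; apply: cvgD; last exact: cvg_cst.
apply: cvgB; first exact: cvg_cst.
apply: cvgM; first exact: cvg_cst.
by apply: cvgD; apply: cvgM; [exact: cvg_cst|exact: continuous_cos|exact: cvg_cst|exact: continuous_sin].
Qed.

Lemma continuous_pdenV z : cabs z < 1 -> continuous (fun t => (pden z t)^-1).
Proof.
by move=> z1 t; apply: cvgV; [rewrite gt_eqF// pden_gt0|exact: continuous_pden].
Qed.

Lemma continuous_poisson z : cabs z < 1 -> continuous (poisson_kernel z).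
Proof.
move=> z1; rewrite (_ : poisson_kernel z = (fun t => c * (1 - cabs z ^+ 2) * (pden z t)^-1)); last first.
  by apply/funext => t; rewrite poisson_kernelE.
by move=> t; apply: cvgM; [exact: cvg_cst|exact: continuous_pdenV].
Qed.

Lemma continuous_dpoisson z : cabs z < 1 -> continuous (dpoisson z).
Proof.
move=> z1 t; rewrite /dpoisson; apply: cvgM; first exact: cvg_cst.
apply: cvgM; last by apply: cvgM; exact: continuous_pdenV.
apply: cvgN; apply: cvgM; first exact: cvg_cst.
by apply: cvgB; apply: cvgM; [exact: cvg_cst|exact: continuous_sin|exact: cvg_cst|exact: continuous_cos].
Qed.

Lemma poisson_bounded z : cabs z < 1 -> exists M : R,
  (forall t, `|poisson_kernel z t| <= M) /\ (forall t, `|dpoisson z t| <= M).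
Proof.
move=> z1; pose d := (1 - cabs z) ^- 2.
have d0 : 0 <= d by rewrite invr_ge0 exprn_ge0; lra.
have pd t : `|(pden z t)^-1| <= d.
  rewrite ger0_norm ?invr_ge0 ?(ltW (pden_gt0 _ _ z1))//.
  by rewrite lef_pV2 ?posrE ?pden_ge ?pden_gt0// exprn_gt0; lra.
have [k [kE k0]] : exists k, `|c * (1 - cabs z ^+ 2)| = k /\ 0 <= k by eexists; split; [reflexivity|].
(* The first summand bounds the kernel. The second bounds its derivative, whose numerator factor
   [2 (x sin t - y cos t)] is at most [4]. One constant serves both, as [periodic_by_parts]
   expects. *)
exists (k * d + k * (4 * d ^+ 2)); split => t.
  rewrite poisson_kernelE normrM kE -[leLHS]addr0 lerD ?ler_wpM2l ?mulr_ge0 ?exprn_ge0//.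
rewrite /dpoisson normrM kE -[leLHS]add0r lerD ?mulr_ge0//; apply: ler_wpM2l => //.
rewrite normrM normrX; apply: ler_pM => //; rewrite ?exprn_ge0//; last by rewrite lerXn2r ?nnegrE.
rewrite normrN normrM ger0_norm//.
have := ler_normB (creal z * sin t) (cimag z * cos t); rewrite !normrM.
have := ler_pM (normr_ge0 _) (normr_ge0 _) (creal_le_cabs z) (sin_max t).
have := ler_pM (normr_ge0 _) (normr_ge0 _) (cimag_le_cabs z) (cos_max t).
lra.
Qed.

(** Over the common denominator [|1 - s|^4], the numerator of [v - conjc v] factors as
    [(s - conjc s) (1 - |s|^2)], and [s - conjc s] is [2 i] times [y cos t - x sin t]. *)
Lemma dpoisson_cauchy z t (v := z * conjc (expi t) * (1 - z * conjc (expi t))^-1 ^+ 2) :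
  cabs z < 1 -> c%:C * (v - conjc v) = 'i%C * (dpoisson z t)%:C.
Proof.
move=> z1; pose s := z * conjc (expi t).
have a0 : 1 - s != 0.
  by apply: (@cabs_1B_neq0 R (fun t => conjc (expi t))) => // t'; rewrite cabsJ cabs_expi.
have b0 : 1 - conjc s != 0 by rewrite -conjc1 -conjB conjc_eq0.
have -> : v - conjc v = (s - conjc s) * (1 - s * conjc s) * ((1 - s) * (1 - conjc s))^-1 ^+ 2.
  rewrite /v -/s conjM conjX conjc_inv conjB conjc1.
  by move: (conjc s) b0 => s' b0; field; rewrite a0 b0.
have -> : (1 - s) * (1 - conjc s) = (pden z t)%:C.
  by rewrite -pdenE cabs_sqrC conjB conjc1.
have -> : s * conjc s = (cabs z ^+ 2)%:C.
  by rewrite -cabs_sqrC /s cabsM cabsJ cabs_expi mulr1.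
have -> : s - conjc s = 'i%C * (- (2 * (creal z * sin t - cimag z * cos t)))%:C.
  by rewrite /s; case: (z) => a b; apply/eqP; rewrite eq_complex /=; apply/andP; split; apply/eqP; ring.
have -> : (pden z t)%:C^-1 ^+ 2 = ((pden z t)^-1 ^+ 2)%:C by rewrite rmorphXn fmorphV.
have -> : 1 - (cabs z ^+ 2)%:C = (1 - cabs z ^+ 2)%:C by rewrite rmorphB rmorph1.
rewrite /dpoisson.
move: ((pden z t)^-1 ^+ 2) (1 - cabs z ^+ 2) (- (2 * _)) => p q r.
rewrite !rmorphM /=; ring.
Qed.

(** * Total mass of the Poisson kernel *)

(** Each integrand is the derivative of a periodic function, so [periodic_by_parts] with [h = 1] and
    [g = 0] gives zero. *)
Lemma int_trig n : (0 < n)%N ->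
  \int[mu]_(t in I) cos (n%:R * t) = 0 /\ \int[mu]_(t in I) sin (n%:R * t) = 0.
Proof.
move=> n0; have nR : n%:R != 0 :> R by rewrite pnatr_eq0 -lt0n.
have n1 : 1 <= n%:R :> R by rewrite ler1n.
have zero (q q' : R -> R) : (forall t : R, is_derive t (1 : R) q (q' t)) ->
  continuous q' -> (forall t, `|q t| <= 1) -> (forall t, `|q' t| <= 1) ->
  q (pi *+ 2) = q 0 -> \int[mu]_(t in I) q' t = 0.
  move=> dq cq' q1 q'1 qp.
  have := @periodic_by_parts R q q' (fun=> 1) (fun=> 0) 1 dq _ q1 q'1 qp erefl.
  under [in LHS]eq_Rintegral do rewrite mulr1.
  under [in RHS]eq_Rintegral do rewrite mulr0.
  rewrite (Rintegral_cst mu measurable_I2pi) mul0r oppr0; apply.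
  - by apply: measurable_funTS; exact: continuous_measurable_fun.
  - move=> e e0; exists 1 => // m s t _ _ _; rewrite big1 => // i _.
    by rewrite subrr normr0.
  - exact: integrable0.
  - by apply/aeW => t _; under eq_fun do rewrite subrr mul0r; exact: cvg_cst.
have per k (f : R -> R) : (forall x, f (x + pi *+ 2) = f x) -> f (k%:R * (pi *+ 2)) = f 0.
  move=> fp; elim: k => [|k IH]; first by rewrite mul0r.
  by rewrite -natr1 mulrDl mul1r fp.
have cn : continuous (fun t : R => n%:R * t).
  by move=> t; apply: cvgM; [exact: cvg_cst|exact: cvg_id].
split.
  apply: (zero (fun t => n%:R^-1 * sin (n%:R * t))).
  - move=> t; apply: is_derive_eq; rewrite /GRing.scale /=; field.
    exact: nR.
  - by move=> t; apply: continuous_comp; [exact: cn|exact: continuous_cos].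
  - move=> t; rewrite normrM ger0_norm ?invr_ge0 ?ler0n// -[leRHS]mulr1 ler_pM ?invr_ge0 ?ler0n//.
      by rewrite invf_le1// ltr0n.
    exact: sin_max.
  - by move=> t; exact: cos_max.
  - by rewrite (per _ sin) ?mulr0// => x; rewrite mulr2n addrA !sinDpi opprK.
apply: (zero (fun t => - (n%:R^-1 * cos (n%:R * t)))).
- move=> t; apply: is_derive_eq; rewrite /GRing.scale /=; field.
  exact: nR.
- by move=> t; apply: continuous_comp; [exact: cn|exact: continuous_sin].
- move=> t; rewrite normrN normrM ger0_norm ?invr_ge0 ?ler0n// -[leRHS]mulr1 ler_pM ?invr_ge0 ?ler0n//.
    by rewrite invf_le1// ltr0n.
  exact: cos_max.
- by move=> t; exact: sin_max.
- by rewrite (per _ cos) ?mulr0// => x; rewrite mulr2n addrA !cosDpi opprK.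
Qed.
Lemma expiX n t : expi t ^+ n = cos (n%:R * t) +i* sin (n%:R * t).
Proof.
elim: n => [|n IH]; first by rewrite expr0 mul0r cos0 sin0.
rewrite exprS IH -natr1 mulrDl mul1r cosD sinD; apply/eqP; rewrite eq_complex /=.
by apply/andP; split; apply/eqP; ring.
Qed.

(* The integrals [E n] of [w^n / (1 - z w)] satisfy [E n = z E n.+1] for [n > 0], so
   [E 1 = z^n E n.+1] tends to [0]. *)
Lemma cauchyT_const w z : ccont w -> (forall t, cabs (w t) = 1) ->
  (forall n, (0 < n)%N -> cint (fun t => w t ^+ n) = 0) -> cabs z < 1 ->
  cauchyT (fun=> 1) w 0 z = (pi *+ 2)%:C.
Proof.
move=> cw w1 w0 z1.
pose E n := cint (fun t => w t ^+ n * (1 - z * w t)^-1).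
have gw n : bmeas (fun t => w t ^+ n) by apply: bmeasX; exact: bmeas_w.
have gE n : bmeas (fun t => w t ^+ n * (1 - z * w t)^-1).
  by apply: bmeasM => //; exact: bmeas_inv1B.
have rec n : E n = cint (fun t => w t ^+ n) + z * E n.+1.
  rewrite /E -cintZ// -cintD//; last by apply: bmeasM => //; exact: bmeas_cst.
  apply: eq_cint => t _; have a0 : 1 - z * w t != 0 by exact: cabs_1B_neq0.
  by rewrite exprS; field.
have E1 n : E 1 = z ^+ n * E n.+1.
  elim: n => [|n IH]; first by rewrite mul1r.
  by rewrite IH rec w0// add0r exprSr mulrA.
have E0 n : cabs (E n) <= (1 - cabs z)^-1 * (pi *+ 4).
  apply: cint_le => // t _; rewrite cabsM cabsX w1 expr1n mul1r.
  exact: cabs_inv1B_le.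
have E10 : E 1 = 0.
  apply/eqP; rewrite -cabs_eq0 eq_le cabs_ge0 andbT.
  set M := _ * _ in E0.
  have lim0 : (fun n => cabs z ^+ n * M) @ \oo --> 0 * M.
    apply: cvgM; last exact: cvg_cst.
    by apply: cvg_expr; rewrite ger0_norm ?cabs_ge0.
  rewrite mul0r in lim0.
  apply: (ler_cvg_to (cvg_cst (cabs (E 1))) lim0).
  by apply: nearW => n; rewrite (E1 n) cabsM cabsX ler_wpM2l ?exprn_ge0 ?cabs_ge0.
transitivity (E 0%N).
  by apply: eq_cint => t _; rewrite mul1r expr1.
rewrite rec E10 mulr0 addr0 /cint; apply/eqP; rewrite eq_complex; apply/andP; split; apply/eqP => /=.
  rewrite (Rintegral_cst mu measurable_I2pi) mul1r; by rewrite [X in fine X]mu_I2pi.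
by rewrite (Rintegral_cst mu measurable_I2pi) mul0r.
Qed.

(** For [F = 1] both Cauchy transforms equal [2 pi], as does the subtracted integral of [1], so the
    Cauchy formula leaves [(2 pi)^-1] times [2 pi]. *)
Lemma int_poisson z : cabs z < 1 -> \int[mu]_(t in I) poisson_kernel z t = 1.
Proof.
move=> z1; have z1' : cabs (conjc z) < 1 by rewrite cabsJ.
have := @poisson_integral_cauchy R (fun=> 1) (bmeas_cst 1) z z1.
rewrite !cauchyT_const//.
- have -> : cint (fun=> 1) = (pi *+ 2)%:C :> R[i].
    rewrite /cint; apply/eqP; rewrite eq_complex; apply/andP; split; apply/eqP => /=.
      rewrite (Rintegral_cst mu measurable_I2pi) mul1r; by rewrite [X in fine X]mu_I2pi.
    by rewrite (Rintegral_cst mu measurable_I2pi) mul0r.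
  rewrite addrK -rmorphM /= mulVf ?gt_eqF ?pi2_gt0// => /(congr1 (@creal R)).
  rewrite /poisson_integral crealD crealM /=.
  under eq_Rintegral do rewrite mulr1.
  by rewrite mul0r mulr0 subr0 addr0.
- exact: ccont_expi.
- by move=> t; rewrite cabs_expi.
- move=> n n0; rewrite /cint; under eq_Rintegral do rewrite expiX /=.
  under [X in _ +i* X]eq_Rintegral do rewrite expiX /=.
  by have [-> ->] := int_trig n n0.
- exact: ccont_expiJ.
- by move=> t; rewrite cabsJ cabs_expi.
- move=> n n0; rewrite /cint; under eq_Rintegral do rewrite -conjX expiX /=.
  under [X in _ +i* X]eq_Rintegral do rewrite -conjX expiX /= -mulN1r.
  have [-> i0] := int_trig n n0.
  rewrite RintegralZl ?i0 ?mulr0//; first exact: measurable_I2pi.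
  apply: (@I2pi_bounded_integrable _ _ 1); last by move=> t _; exact: sin_max.
  apply: measurable_funTS; apply: continuous_measurable_fun => t.
  apply: continuous_comp; last exact: continuous_sin.
  by apply: cvgM; [exact: cvg_cst|exact: cvg_id].
Qed.

End poisson_kernel_facts.

(** * The angular derivative and ellipticity *)

Section angular.
Context {R : realType}.
Notation mu := (@lebesgue_measure R).
Notation I := (@I2pi R).
Variables F G : R -> R[i].
Hypothesis per : forall t, F (t + pi *+ 2) = F t.
Hypothesis acF : abs_cont_on 0 (pi *+ 2) F.
Hypothesis dFG : ae_derivative F G.
Hypothesis iGr : mu.-integrable I (EFin \o (fun t => creal (G t))).
Hypothesis iGi : mu.-integrable I (EFin \o (fun t => cimag (G t))).
Let gF : bmeas F := abs_cont_good _ acF.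
Notation f := (poisson_integral F).
(** A majorant of [|G|], at most [2 |G|], suited to estimating the two components separately. *)
Let g t : R := `|creal (G t)| + `|cimag (G t)|.
Implicit Types z : R[i].

Lemma integrable_poisson_mul z (h : R -> R) : cabs z < 1 -> mu.-integrable I (EFin \o h) ->
  mu.-integrable I (EFin \o (fun t => poisson_kernel z t * h t)).
Proof.
move=> z1 ih; have [M [HM _]] := poisson_bounded _ z1.
apply: (@integrable_bounded_mul _ _ _ M) => //.
by apply: measurable_funTS; apply: continuous_measurable_fun; exact: continuous_poisson.
Qed.

Lemma integrable_norm_parts : mu.-integrable I (EFin \o g).
Proof.
have n1 : mu.-integrable I (EFin \o (fun t => `|creal (G t)|)) by move/integrable_abse : iGr.
have n2 : mu.-integrable I (EFin \o (fun t => `|cimag (G t)|)) by move/integrable_abse : iGi.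
by apply: (integrableD _ n1 n2); exact: measurable_I2pi.
Qed.

Lemma poisson_parts z : cabs z < 1 ->
  \int[mu]_(t in I) (dpoisson z t * creal (F t)) =
    - (\int[mu]_(t in I) (poisson_kernel z t * creal (G t))) /\
  \int[mu]_(t in I) (dpoisson z t * cimag (F t)) =
    - \int[mu]_(t in I) (poisson_kernel z t * cimag (G t)).
Proof.
move=> z1; have [M [HM HM']] := poisson_bounded _ z1.
have md : measurable_fun I (dpoisson z).
  by apply: measurable_funTS; apply: continuous_measurable_fun; exact: continuous_dpoisson.
have pp : poisson_kernel z (pi *+ 2) = poisson_kernel z 0.
  rewrite !poisson_kernelE /pden (_ : pi *+ 2 = 0 + pi + pi) ?add0r ?mulr2n//.
  by rewrite cosDpi sinDpi cospi sinpi cos0 sin0 opprK oppr0.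
have Fp : F (pi *+ 2) = F 0 by rewrite -(per 0) add0r.
have aeF := ae_filter_ringOfSetsType mu.
have sub t : 0 < t < pi *+ 2 -> I t by move=> /andP[t0 t1]; rewrite /I2pi /= in_itv/= !ltW.
have dq t : is_derive t (1 : R) (poisson_kernel z) (dpoisson z t) by exact: is_derive_poisson.
split.
  apply: (@periodic_by_parts R _ _ _ (fun t => creal (G t)) M dq md HM HM' pp _ _ iGr).
  - by rewrite Fp.
  - exact: abs_cont_creal.
  - apply: filterS dFG => t dt /sub /dt /(@cvgC_creal _ _ _ _ _ _).
    by under eq_fun do rewrite crealdR crealB.
apply: (@periodic_by_parts R _ _ _ (fun t => cimag (G t)) M dq md HM HM' pp _ _ iGi).
- by rewrite Fp.
- exact: abs_cont_cimag.
- apply: filterS dFG => t dt /sub /dt /(@cvgC_cimag _ _ _ _ _ _).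
  by under eq_fun do rewrite cimagdR cimagB.
Qed.

Lemma angular_bound z : cabs z < 1 ->
  cabs (z * dz f z - conjc z * dzbar f z) <= \int[mu]_(t in I) (poisson_kernel z t * g t).
Proof.
move=> z1; rewrite (dz_dzbar_poisson _ gF)//.
have [M [HM HM']] := poisson_bounded _ z1.
have gd : bmeas (fun t => (dpoisson z t)%:C).
  apply: (@bmeas_ccont _ _ M); last by move=> t; rewrite cabs_real.
  by split; [exact: continuous_dpoisson|exact: (fun _ => cvg_cst _)].
have gdF := bmeasM _ _ gd gF.
(* The integrand is a constant multiple of [dpoisson] times [F], from which it inherits
   measurability and boundedness. *)
have gK : bmeas (fun t : R => F t * (z * conjc (expi t) * (1 - z * conjc (expi t))^-1 ^+ 2 -
    conjc (z * conjc (expi t) * (1 - z * conjc (expi t))^-1 ^+ 2))).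
  have pi0 : ((pi *+ 2)^-1 : R)%:C != 0 :> R[i] by rewrite fmorph_eq0 invr_eq0 gt_eqF ?pi2_gt0.
  have -> : (fun t : R => F t * (z * conjc (expi t) * (1 - z * conjc (expi t))^-1 ^+ 2 -
    conjc (z * conjc (expi t) * (1 - z * conjc (expi t))^-1 ^+ 2))) =
    (fun t => (((pi *+ 2)^-1)%:C^-1 * 'i%C) * ((dpoisson z t)%:C * F t)).
    apply/funext => t; apply: (mulfI pi0); rewrite mulrCA dpoisson_cauchy//.
    by move: pi0; move: ((pi *+ 2)^-1)%:C => k k0; field.
  by apply: bmeasM => //; exact: bmeas_cst.
rewrite -cintZ//.
rewrite (eq_cint _ (fun t => 'i%C * ((dpoisson z t)%:C * F t))); last first.
  by move=> t _; rewrite mulrCA dpoisson_cauchy//; ring.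
rewrite cintZ// cabsM cabs_i mul1r.
have [p1 p2] := poisson_parts z z1.
have ir := integrable_poisson_mul z _ z1 iGr; have ii := integrable_poisson_mul z _ z1 iGi.
have -> : cint (fun t => (dpoisson z t)%:C * F t) =
   (- \int[mu]_(t in I) (poisson_kernel z t * creal (G t))) +i*
   (- \int[mu]_(t in I) (poisson_kernel z t * cimag (G t))).
  rewrite -p1 -p2 /cint; congr (_ +i* _).
    by apply: eq_Rintegral => t _; rewrite crealM /= mul0r subr0.
  by apply: eq_Rintegral => t _; rewrite cimagM /= mul0r addr0.
apply: le_trans (cabs_le _) _; rewrite /= !normrN.
have mI := @measurable_I2pi R.
have bnd (h : R -> R) : mu.-integrable I (EFin \o h) ->
   `|\int[mu]_(t in I) (poisson_kernel z t * h t)| <=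
   \int[mu]_(t in I) (poisson_kernel z t * `|h t|).
  move=> ih; apply: le_trans (le_normr_Rintegral _ (integrable_poisson_mul z _ z1 ih)) _; first exact: mI.
  under eq_Rintegral do rewrite normrM (ger0_norm (poisson_kernel_ge0 _ _ z1)).
  by [].
apply: le_trans (lerD (bnd _ iGr) (bnd _ iGi)) _.
rewrite -RintegralD//.
- by under [leRHS]eq_Rintegral do rewrite mulrDr.
- by apply: integrable_poisson_mul => //; move/integrable_abse : iGr.
- by apply: integrable_poisson_mul => //; move/integrable_abse : iGi.
Qed.

Lemma elliptic_bound (K K' : R) z : 1 <= K -> 0 <= K' -> elliptic K K' f -> 2^-1 <= cabs z < 1 ->
  normD f z <= 2 * K * (\int[mu]_(t in I) (poisson_kernel z t * g t)) + Num.sqrt K'.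
Proof.
move=> K1 K'0 [_ _ J0 ell] /andP[z2 z1].
have := angular_bound z z1; set N := \int[mu]_(t in I) _ => aN.
have := J0 z z1; have := ell z z1; rewrite /normD /Defs.jacobian => E J.
have := lecabs_sub (z * dz f z) (conjc z * dzbar f z); rewrite (cabsM z) (cabsM (conjc z)) cabsJ.
move: E J; have := cabs_ge0 (dz f z); have := cabs_ge0 (dzbar f z).
set a := cabs (dz f z); set b := cabs (dzbar f z) => b0 a0 E J ab.
have s0 := sqrtr_ge0 K'; have s2 := sqr_sqrtr K'0; set s := Num.sqrt K' in s0 s2 *.
(* The Jacobian is [(a - b) (a + b)], so its positivity decides the sign of [a - b]. *)
have l0 : 0 < a - b by rewrite ltNge; apply/negP => ?; nra.
have lN : a - b <= 2 * N.
  have : cabs z * (a - b) <= N by rewrite mulrBr; lra.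
  nra.
(* Otherwise [a + b] and [a + b - K (a - b)] would both exceed [s], and their product would exceed
   [K'], against ellipticity. *)
have : a + b <= K * (a - b) + s.
  rewrite leNgt; apply/negP => H.
  have Kl : 0 <= K * (a - b) by rewrite mulr_ge0; lra.
  have : s ^+ 2 < (a + b) * (a + b - K * (a - b)) by nra.
  rewrite s2; nra.
nra.
Qed.

End angular.

(** * Means over circles *)

Section lp.
Context {R : realType}.
Notation mu := (@lebesgue_measure R).
Notation I := (@I2pi R).
Implicit Types (z : R[i]) (g u : R -> R).

(** Read off from the definition of the integral as a supremum over simple functions, so that it
    applies to the means of an arbitrary [h]. *)
Lemma ge0_le_integral_all (f1 f2 : R -> \bar R) : 
  (forall t, I t -> (0 <= f1 t)%E) -> (forall t, I t -> (f1 t <= f2 t)%E) ->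
  (\int[mu]_(t in I) f1 t <= \int[mu]_(t in I) f2 t)%E.
Proof.
move=> f0 f12; rewrite !ge0_integralE//; last by move=> t It; apply: le_trans (f0 t It) (f12 t It).
apply: le_ereal_sup => _ [h /= hf <-]; exists h => // t; apply: le_trans (hf t) _.
by rewrite !patchE; case: ifPn => // /set_mem It; exact: f12.
Qed.

Lemma EFin_Rint (h : R -> R) : mu.-integrable I (EFin \o h) ->
  (\int[mu]_(t in I) h t)%:E = (\int[mu]_(t in I) (h t)%:E)%E.
Proof. by move=> ih; rewrite fineK//; apply: integrable_fin_num => //; exact: measurable_I2pi. Qed.

Lemma poisson_rot (rho th t : R) : 
  poisson_kernel (rho%:C * expi th) t = poisson_kernel rho%:C (th - t).
Proof.
rewrite !poisson_kernelE /pden cabsM cabs_expi mulr1 cosB /=.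
congr (_ * _); congr (_ ^-1); congr (_ + _); congr (_ - _); ring.
Qed.

(** The kernel depends only on [th - t], and evenly. This symmetry converts integration over the
    circle of radius [rho] into integration over the boundary variable, where the mass is one. *)
Lemma poisson_rotC (rho th t : R) : 
  poisson_kernel (rho%:C * expi th) t = poisson_kernel (rho%:C * expi t) th.
Proof.
rewrite !poisson_rot !poisson_kernelE /pden /= !mul0r.
by rewrite -(opprB t th) cosN.
Qed.

Lemma poisson_tonelli (rho : R) u : 0 < rho < 1 -> (forall t, 0 <= u t) ->
  mu.-integrable I (EFin \o u) ->
  measurable_fun I (fun th => (\int[mu]_(t in I) (poisson_kernel (rho%:C * expi th) t * u t))%:E) /\
  (\int[mu]_(th in I) (\int[mu]_(t in I) (poisson_kernel (rho%:C * expi th) t * u t))%:E =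
   \int[mu]_(t in I) (u t)%:E)%E.
Proof.
move=> /andP[r0 r1] u0 iu; have mI := @measurable_I2pi R.
have mu_ : measurable_fun I u by apply/measurable_EFinP; exact: (measurable_int _ iu).
have cr th : cabs (rho%:C * expi th) < 1 by rewrite cabsM cabs_expi mulr1 cabs_real gtr0_norm.
have cr' : cabs rho%:C < 1 by rewrite cabs_real gtr0_norm.
pose v := u \_ I.
have mv : measurable_fun setT v by apply/(measurable_restrictT _ _).1.
have v0 t : 0 <= v t by rewrite /v patchE; case: ifP.
pose i1 : R -> R := \1_I.
have mi1 : measurable_fun setT i1 by exact: measurable_indic.
(* Both variables are cut off to [I], so that Tonelli's theorem is applied on the whole plane. *)
pose ker (x : R * R) : \bar R := (poisson_kernel rho%:C (x.1 - x.2) * (i1 x.1 * v x.2))%:E.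
have mker : measurable_fun setT ker.
  apply/measurable_EFinP; apply: measurable_funM.
    apply: measurableT_comp; first by apply: continuous_measurable_fun; exact: continuous_poisson.
    by apply: measurable_funB; [exact: measurable_fst|exact: measurable_snd].
  by apply: measurable_funM; apply: measurableT_comp.
have ker0 x : (0 <= ker x)%E.
  by rewrite lee_fin mulr_ge0 ?poisson_kernel_ge0// mulr_ge0// /i1 indicE; case: (_ \in _).
have inner1 th : I th -> (\int[mu]_t ker (th, t) =
   (\int[mu]_(t in I) (poisson_kernel (rho%:C * expi th) t * u t))%:E)%E.
  move=> Ith; rewrite EFin_Rint; last exact: integrable_poisson_mul.
  rewrite [RHS]integral_mkcond; apply: eq_integral => t _.
  rewrite /ker /= /i1 indicE mem_set// mul1r /v !patchE poisson_rot; case: ifP => //.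
  by rewrite mulr0.
have inner2 t : I t -> (\int[mu]_th ker (th, t) = (u t)%:E)%E.
  move=> It; transitivity (\int[mu]_(th in I) (u t * poisson_kernel (rho%:C * expi t) th)%:E)%E.
    rewrite [RHS]integral_mkcond; apply: eq_integral => th _.
    rewrite /ker /= /i1 indicE /v !patchE (mem_set It); case: (th \in I).
      by rewrite mul1r mulrC -poisson_rot poisson_rotC.
    by rewrite mul0r mulr0.
  have ip : mu.-integrable I (EFin \o poisson_kernel (rho%:C * expi t)).
    have [M [HM _]] := poisson_bounded _ (cr t).
    apply: (@I2pi_bounded_integrable _ _ M) => //.
    by apply: measurable_funTS; apply: continuous_measurable_fun; exact: continuous_poisson.
  under eq_integral do rewrite EFinM.
  rewrite integralZl//= -EFin_Rint// int_poisson//.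
  by rewrite mule1.
split.
  apply: (eq_measurable_fun (fun th => \int[mu]_t ker (th, t))%E).
    by move=> th /set_mem Ith; exact: inner1.
  apply: measurable_funTS.
  have H := @measurable_fun_fubini_tonelli_F _ _ (measurableTypeR R) (measurableTypeR R) R mu ker mker ker0.
  exact H.
transitivity (\int[mu]_th \int[mu]_t ker (th, t))%E.
  rewrite [LHS]integral_mkcond; apply: eq_integral => th _.
  rewrite patchE; case: ifPn => [/set_mem/inner1 //|Ith].
  rewrite integral0_eq// => t _; rewrite /ker /= /i1 indicE (negbTE Ith) mul0r mulr0//.
have FT := @fubini_tonelli _ _ (measurableTypeR R) (measurableTypeR R) R mu mu ker mker ker0.
etransitivity; first exact FT.
rewrite [RHS]integral_mkcond; apply: eq_integral => t _.
rewrite patchE; case: ifPn => [/set_mem/inner2 //|It].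
by rewrite integral0_eq// => th _; rewrite /ker /= /v patchE (negbTE It) !mulr0.
Qed.

(** Let [N] be the Poisson integral of [g]. Young's inequality bounds [N^(r-1) g] by
    [N^r / q + g^r / r]; integrating against a kernel of mass one makes the left side [N^r], and
    [1 - 1/q = 1/r] finishes. *)
Lemma poisson_jensen z g (r : R) : 1 <= r -> cabs z < 1 -> (forall t, 0 <= g t) ->
  mu.-integrable I (EFin \o g) -> mu.-integrable I (EFin \o (fun t => g t `^ r)) ->
  (\int[mu]_(t in I) (poisson_kernel z t * g t)) `^ r <=
  \int[mu]_(t in I) (poisson_kernel z t * g t `^ r).
Proof.
move=> r1 z1 g0 ig igr; have mI := @measurable_I2pi R.
have P0 t := poisson_kernel_ge0 z t z1.
set N := \int[mu]_(t in I) _.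
have N0 : 0 <= N by apply: Rintegral_ge0 => t _; rewrite mulr_ge0.
(* The exponent [r = 1] is set apart because its conjugate [q] is infinite. *)
have [r1'|rne] := eqVneq r 1.
  rewrite r1' powRr1//; under [leRHS]eq_Rintegral do rewrite powRr1//.
  by [].
have lt1r : 1 < r by rewrite lt_neqAle eq_sym rne.
pose q := r / (r - 1).
have rm : 0 < r - 1 by lra.
have q0 : 0 < q by rewrite divr_gt0//; lra.
have pq : q^-1 + r^-1 = 1 by rewrite /q; field; apply/andP; split; lra.
have ip : mu.-integrable I (EFin \o poisson_kernel z).
  have [M [HM _]] := poisson_bounded _ z1.
  apply: (@I2pi_bounded_integrable _ _ M) => //.
  by apply: measurable_funTS; apply: continuous_measurable_fun; exact: continuous_poisson.
have i1 := integrable_poisson_mul _ _ z1 ig; have i2 := integrable_poisson_mul _ _ z1 igr.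
have : \int[mu]_(t in I) (N `^ (r - 1) * (poisson_kernel z t * g t)) <=
  \int[mu]_(t in I) (N `^ r / q * poisson_kernel z t + r^-1 * (poisson_kernel z t * g t `^ r)).
  apply: le_Rintegral => //; first exact: I2pi_integrableZl.
    by apply: (integrableD _ (I2pi_integrableZl _ _ ip) (I2pi_integrableZl _ _ i2)); exact: mI.
  move=> t _; have := conjugate_powR (powR_ge0 N (r - 1)) (g0 t) q0 (lt_le_trans ltr01 r1) pq.
  rewrite -powRrM (_ : (r - 1) * q = r); last by rewrite /q; field; lra.
  move=> /(ler_wpM2l (P0 t)); rewrite mulrCA => /le_trans; apply.
  by rewrite le_eqVlt; apply/orP; left; apply/eqP; ring.
rewrite RintegralD//; [|exact: I2pi_integrableZl|exact: I2pi_integrableZl].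
rewrite (RintegralZl _ _ i1)// (RintegralZl _ _ ip)// (RintegralZl _ _ i2)// int_poisson// mulr1 -/N.
have -> : N `^ (r - 1) * N = N `^ r.
  by rewrite mulrC mulr_powRB1//; lra.
set J := \int[mu]_(t in I) _ => H.
have qE : q^-1 = 1 - r^-1 by rewrite -pq; ring.
have ri : 0 < r^-1 by rewrite invr_gt0; lra.
move: H; rewrite qE mulrBr mulr1 => H.
have : r^-1 * N `^ r <= r^-1 * J by lra.
by rewrite ler_pM2l.
Qed.

(** The sum is at most twice the larger term. *)
Lemma powRD_le (x y r : R) : 0 <= x -> 0 <= y -> 0 <= r ->
  (x + y) `^ r <= 2 `^ r * (x `^ r + y `^ r).
Proof.
move=> x0 y0 r0.
have [xy|yx] := leP x y.
  apply: (@le_trans _ _ ((2 * y) `^ r)).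
    by apply: ge0_ler_powR; rewrite ?nnegrE; lra.
  by rewrite powRM// ler_wpM2l ?powR_ge0// lerDr powR_ge0.
apply: (@le_trans _ _ ((2 * x) `^ r)).
  by apply: ge0_ler_powR; rewrite ?nnegrE; lra.
by rewrite powRM// ler_wpM2l ?powR_ge0// lerDl powR_ge0.
Qed.

Lemma hardy_mean_bound (h : R[i] -> R) g (r A1 A2 : R) : 1 <= r -> 0 <= A1 -> 0 <= A2 ->
  (forall z, 0 <= h z) -> (forall t, 0 <= g t) ->
  mu.-integrable I (EFin \o g) -> mu.-integrable I (EFin \o (fun t => g t `^ r)) ->
  (forall z, cabs z < 1 -> h z <= A1 * (\int[mu]_(t in I) (poisson_kernel z t * g t)) + A2) ->
  exists M : R, forall rho : R, 0 < rho < 1 ->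
   ((((pi *+ 2)^-1)%:E * \int[mu]_(t in I) (h (rho%:C * expi t) `^ r)%:E) `^ r^-1 <= M%:E)%E.
Proof.
move=> r1 A10 A20 h0 g0 ig igr hN; have mI := @measurable_I2pi R.
pose C1 := 2 `^ r * A1 `^ r; pose C2 := 2 `^ r * A2 `^ r.
have C10 : 0 <= C1 by rewrite mulr_ge0 ?powR_ge0.
have C20 : 0 <= C2 by rewrite mulr_ge0 ?powR_ge0.
pose B := \int[mu]_(t in I) (g t `^ r).
(* [C1] and [C2] come from splitting [(A1 N + A2)^r]. By Jensen and Tonelli the mean of [N^r] costs
   at most [B], uniformly in [rho], and the constant term integrates to [2 pi C2]. *)
exists (((pi *+ 2)^-1 * (C1 * B + C2 * (pi *+ 2))) `^ r^-1) => rho rho01.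
have [mU UE] := poisson_tonelli rho (fun t => g t `^ r) rho01 (fun t => powR_ge0 _ _) igr.
have cr th : cabs (rho%:C * expi th) < 1.
  by case/andP: rho01 => ? ?; rewrite cabsM cabs_expi mulr1 cabs_real gtr0_norm.
set U := fun th => _ in mU UE.
have U0 th : (0 <= (U th))%E.
  rewrite lee_fin; apply: Rintegral_ge0 => t _; rewrite mulr_ge0 ?powR_ge0//.
  exact: poisson_kernel_ge0.
have le : (\int[mu]_(t in I) (h (rho%:C * expi t) `^ r)%:E <= (C1 * B + C2 * (pi *+ 2))%:E)%E.
  apply: (@le_trans _ _ (\int[mu]_(t in I) (C1%:E * U t + C2%:E))%E).
    apply: ge0_le_integral_all => t It; first by rewrite lee_fin powR_ge0.
    rewrite -EFinM -EFinD lee_fin.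
    set N := \int[mu]_(s in I) (poisson_kernel (rho%:C * expi t) s * g s).
    have N0 : 0 <= N.
      by apply: Rintegral_ge0 => s _; rewrite mulr_ge0// poisson_kernel_ge0.
    apply: (@le_trans _ _ ((A1 * N + A2) `^ r)).
      apply: ge0_ler_powR; rewrite ?nnegrE ?addr_ge0 ?mulr_ge0//; first by lra.
      exact: hN.
    apply: le_trans (powRD_le _ _ _ _ _ _) _; rewrite ?mulr_ge0//; first by lra.
    rewrite mulrDr lerD2r powRM// mulrA ler_wpM2l//.
    exact: poisson_jensen.
  rewrite ge0_integralD//; last 2 first.
  - by move=> t _; rewrite mule_ge0// lee_fin.
  - by apply: emeasurable_funM => //; exact: measurable_cst.
  rewrite ge0_integralZl_EFin// UE -EFin_Rint// integral_cst// [X in (_ + _ * X)%E]mu_I2pi.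
  by rewrite -!EFinM -EFinD.
rewrite -poweR_EFin; apply: gt0_ler_poweR.
- by rewrite invr_ge0; lra.
- rewrite in_itv/= leey andbT mule_ge0// ?lee_fin ?invr_ge0 ?(ltW (@pi2_gt0 R))//.
  by apply: integral_ge0 => t _; rewrite lee_fin powR_ge0.
- rewrite in_itv/= leey andbT lee_fin mulr_ge0 ?invr_ge0 ?(ltW (@pi2_gt0 R))//.
  rewrite addr_ge0// mulr_ge0// ?(ltW (@pi2_gt0 R))//.
  by apply: Rintegral_ge0 => t _; rewrite powR_ge0.
- by rewrite EFinM lee_wpmul2l// lee_fin invr_ge0 ltW// pi2_gt0.
Qed.

End lp.

(** * Integrability of the boundary derivative *)

Section lp_data.
Context {R : realType}.
Notation mu := (@lebesgue_measure R).
Notation I := (@I2pi R).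
Variable G : R -> R[i].
Hypothesis mGr : measurable_fun I (fun t => creal (G t)).
Hypothesis mGi : measurable_fun I (fun t => cimag (G t)).
Let mI : measurable (I : set (measurableTypeR R)) := @measurable_I2pi R.

Lemma le_cabs_integrable (h : R -> R) : mu.-integrable I (EFin \o h) ->
  (forall t, cabs (G t) <= h t) ->
  mu.-integrable I (EFin \o (fun t => creal (G t))) /\
  mu.-integrable I (EFin \o (fun t => cimag (G t))).
Proof.
move=> ih Gh; split; apply: (le_integrable mI _ _ ih).
- exact/measurable_EFinP.
- move=> t _; rewrite /= lee_fin; apply: le_trans (creal_le_cabs _) _.
  exact: le_trans (Gh t) (ler_norm _).
- exact/measurable_EFinP.
- move=> t _; rewrite /= lee_fin; apply: le_trans (cimag_le_cabs _) _.
  exact: le_trans (Gh t) (ler_norm _).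
Qed.

Lemma measurable_cabs : measurable_fun I (fun t => cabs (G t)).
Proof.
apply: measurableT_comp; first by apply: continuous_measurable_fun; exact: sqrt_continuous.
by apply: measurable_funD; exact: measurable_funX.
Qed.

(** The circle has finite measure and [|G| <= 1 + |G|^r], so the components are integrable; the last
    claim follows from [|creal (G t)| + |cimag (G t)| <= 2 |G|]. *)
Lemma Lp_finite_integrable (r : R) : 1 <= r ->
  (\int[mu]_(t in I) (cabs (G t) `^ r)%:E < +oo)%E ->
  [/\ mu.-integrable I (EFin \o (fun t => creal (G t))),
      mu.-integrable I (EFin \o (fun t => cimag (G t))) &
      mu.-integrable I (EFin \o (fun t => (`|creal (G t)| + `|cimag (G t)|) `^ r))].
Proof.
move=> r1 fin.
have ic : mu.-integrable I (EFin \o (fun t => cabs (G t) `^ r)).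
  apply/integrableP; split.
    apply/measurable_EFinP; exact: (measurableT_comp (measurable_powR r) measurable_cabs).
  by under eq_integral do rewrite /= ger0_norm ?powR_ge0//.
have i1 : mu.-integrable I (EFin \o (fun=> 1 : R)).
  by apply: (@I2pi_bounded_integrable _ _ 1) => // t _; rewrite normr1.
have i1c : mu.-integrable I (EFin \o (fun t => 1 + cabs (G t) `^ r)).
  by apply: (integrableD _ i1 ic); exact: mI.
have [ir ii] : mu.-integrable I (EFin \o (fun t => creal (G t))) /\
  mu.-integrable I (EFin \o (fun t => cimag (G t))).
  apply: (le_cabs_integrable _ i1c) => t.
  have := powR_ge0 (cabs (G t)) r; have [c1|c1] := leP (cabs (G t)) 1; first by lra.
  by have := le1r_powR (ltW c1) r1; lra.
split => //.
have iZ := I2pi_integrableZl (2 `^ r) _ ic.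
apply: (le_integrable mI _ _ iZ).
  apply/measurable_EFinP; apply: (measurableT_comp (measurable_powR r)).
  by apply: measurable_funD; apply: measurableT_comp => //; exact: normr_measurable.
move=> t _; rewrite /= lee_fin [leLHS]ger0_norm ?powR_ge0// [leRHS]ger0_norm ?mulr_ge0 ?powR_ge0//.
rewrite -powRM ?cabs_ge0//; apply: ge0_ler_powR; rewrite ?nnegrE ?mulr_ge0 ?addr_ge0 ?cabs_ge0//.
  by lra.
by have := creal_le_cabs (G t); have := cimag_le_cabs (G t); lra.
Qed.

Lemma Linfty_poisson (M : R) : {ae mu, forall t, I t -> cabs (G t) <= M} ->
  [/\ mu.-integrable I (EFin \o (fun t => creal (G t))),
      mu.-integrable I (EFin \o (fun t => cimag (G t))) &
      forall z, cabs z < 1 ->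
      \int[mu]_(t in I) (poisson_kernel z t * (`|creal (G t)| + `|cimag (G t)|)) <= 2 * `|M|].
Proof.
move=> GM; have aeF := ae_filter_ringOfSetsType mu.
have iM (x : R) : mu.-integrable I (EFin \o (fun=> x)).
  by apply: (@I2pi_bounded_integrable _ _ `|x|) => //; exact: measurable_cst.
have int_le (h : R -> R) : measurable_fun I h -> (forall t, `|h t| <= cabs (G t)) ->
    mu.-integrable I (EFin \o h).
  move=> mh hG; apply/integrableP; split; first exact/measurable_EFinP.
  have /integrableP[_] := iM M; apply: le_lt_trans.
  apply: ae_ge0_le_integral => //.
  - by apply: measurableT_comp => //; exact/measurable_EFinP.
  - apply: filterS GM => t Gt It; rewrite /= lee_fin.
    by apply: le_trans (hG t) _; apply: le_trans (Gt It) (ler_norm _).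
have ir := int_le _ mGr (fun t => creal_le_cabs (G t)).
have ii := int_le _ mGi (fun t => cimag_le_cabs (G t)).
split => // z z1.
have P0 t := poisson_kernel_ge0 z t z1.
have ip := integrable_poisson_mul z _ z1 (integrable_norm_parts _ ir ii).
have iq := integrable_poisson_mul z _ z1 (iM (2 * `|M|)).
(* Since the kernel has mass one, the constant is its own Poisson integral, and an almost everywhere
   comparison of integrands remains. *)
have -> : 2 * `|M| = \int[mu]_(t in I) (poisson_kernel z t * (2 * `|M|)).
  rewrite (RintegralZr _ mI) ?int_poisson ?mul1r//.
  by have := integrable_poisson_mul z _ z1 (iM 1); under eq_fun do rewrite /= mulr1.
rewrite -lee_fin !EFin_Rint//; apply: ae_ge0_le_integral => //.
- by move=> t _; rewrite lee_fin mulr_ge0// addr_ge0.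
- exact: (measurable_int _ ip).
- by move=> t _; rewrite lee_fin mulr_ge0// mulr_ge0.
- exact: (measurable_int _ iq).
- apply: filterS GM => t Gt It; rewrite lee_fin ler_wpM2l//.
  have := Gt It; have := ler_norm M; have := creal_le_cabs (G t); have := cimag_le_cabs (G t); lra.
Qed.

End lp_data.

(** * From the bound on [normD] to the Hardy space *)

(** [f_z] and the conjugate of [f_zbar] enter only through analyticity and the bound by [normD], so
    a common argument serves both. *)
Lemma hardy_of_normD (R : realType) (p : \bar R) (K K' : R) (F G : R -> R[i]) (h : R[i] -> R[i]) :
  (1 <= p)%E -> 1 <= K -> 0 <= K' -> (forall t, F (t + pi *+ 2) = F t) ->
  abs_cont_on 0 (pi *+ 2) F -> ae_derivative F G -> Lp_circle p G ->
  elliptic K K' (poisson_integral F) ->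
  analytic_on_disk h -> (forall z, cabs (h z) <= normD (poisson_integral F) z) ->
  hardy p h.
Proof.
move=> p1 K1 K'0 per acF dFG LpG ell ah hD; split => //.
have [M0 HM0] := normD_poisson_bounded _ (abs_cont_good _ acF).
(* Adding the bound of the inner disk to the constant gives a single affine estimate valid on the
   whole disk, as [N] is non-negative. *)
pose A2 := Num.sqrt K' + `|M0|.
have A20 : 0 <= A2 by rewrite addr_ge0 ?sqrtr_ge0.
have K20 : 0 <= 2 * K by lra.
pose g t := `|creal (G t)| + `|cimag (G t)|.
have g0 t : 0 <= g t by rewrite addr_ge0.
pose N z := (\int[lebesgue_measure]_(t in @I2pi R) (poisson_kernel z t * g t)).
have hN : lebesgue_measure.-integrable (@I2pi R) (EFin \o (fun t => creal (G t))) ->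
   lebesgue_measure.-integrable (@I2pi R) (EFin \o (fun t => cimag (G t))) ->
   forall z, cabs z < 1 -> cabs (h z) <= 2 * K * N z + A2.
  move=> ir ii z z1; apply: le_trans (hD z) _.
  have N0 : 0 <= N z by apply: Rintegral_ge0 => t _; rewrite mulr_ge0// poisson_kernel_ge0.
  have KN := mulr_ge0 K20 N0; have s0 := sqrtr_ge0 K'; have m0 := normr_ge0 M0.
  have [z2|z2] := leP (cabs z) 2^-1.
    by rewrite /A2; have := HM0 z z2; have := ler_norm M0; lra.
  have z12 : 2^-1 <= cabs z < 1 by rewrite (ltW z2).
  have := elliptic_bound _ _ per acF dFG ir ii K K' z K1 K'0 ell z12.
  by rewrite -/(N z) /A2; lra.
case: p p1 LpG => [r||] // p1 [mr mi fin].
- have r1 : 1 <= r by rewrite -lee_fin.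
  have [ir ii igr] := Lp_finite_integrable _ mr mi _ r1 fin.
  have ig := integrable_norm_parts _ ir ii.
  apply: (@hardy_mean_bound R (fun z => cabs (h z)) g r (2 * K) A2) => //.
  + by move=> z; exact: cabs_ge0.
  + by move=> z z1; exact: hN.
- have [M GM] := fin; have [ir ii NM] := Linfty_poisson _ mr mi _ GM.
  exists (2 * K * (2 * `|M|) + A2) => z z1.
  apply: le_trans (hN ir ii z z1) _; rewrite lerD2r ler_wpM2l//.
  exact: NM.
Qed.

Theorem theorem2 (R : realType) (p : \bar R) (K K' : R) (F : R -> R[i]) :
  (1 <= p)%E -> 1 <= K -> 0 <= K' ->
  (forall t, F (t + pi *+ 2) = F t) ->
  abs_cont_on 0 (pi *+ 2) F ->
  (exists G : R -> R[i], ae_derivative F G /\ Lp_circle p G) ->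
  elliptic K K' (poisson_integral F) ->
  hardy p (dz (poisson_integral F)) /\
  hardy p (fun z => (dzbar (poisson_integral F) z)^*).
Proof.
move=> p1 K1 K'0 per acF [G [dFG LpG]] ell; have gF := abs_cont_good _ acF.
split.
  apply: (hardy_of_normD _ _ _ _ F G) ell _ _ => //; first exact: analytic_dz_poisson.
  by move=> z; rewrite lerDl cabs_ge0.
apply: (hardy_of_normD _ _ _ _ F G) ell _ _ => //; first exact: analytic_dzbar_poisson.
by move=> z; rewrite cabsJ lerDr cabs_ge0.
Qed.
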